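(* Let $\mu$ be a finite positive Borel measure with infinite support, supported on an interval $I\subset\mathbb{R}$ with $c=\inf I\in\mathbb{R}$. Let $r\ge0$ be an integer and $M_0,\dots,M_r>0$. Let $\{p_n^{[2j]}\}_{n\ge0}$ be the orthonormal polynomials with respect to $(x-c)^{2j}\,d\mu(x)$ and $\{q_n\}_{n\ge0}$ the orthonormal polynomials with respect to $\langle p,q\rangle=\int p(x)q(x)\,d\mu(x)+\sum_{i=0}^r M_i\,p^{(i)}(c)\,q^{(i)}(c)$. Let $\{a_n\}$, $\{b_n\}$ be sequences of positive numbers such that $$a_n^{-1/2}\cong A\,n^{a},\qquad b_n\cong B\,n^{b},$$ with real constants $a$ and $A,B,b>0$, and let $\nu>-1$ be such that $2a+1=b(\nu+1)$. Suppose that for all $j=0,1,\dots,r+1$, $$\lim_n\,(-1)^n\frac{a_n^{1/2}}{b_n^{j}}\,p_n^{[2j]}\Big(c+\frac{z^2}{b_n}\Big)=z^{-(\nu+2j)}J_{\nu+2j}(2z)$$ uniformly on compact subsets of $\mathbb{C}$. Then $$\lim_n\,(-1)^n a_n^{1/2}\,q_n\Big(c+\frac{z^2}{b_n}\Big)=(-1)^{r+1}z^{-\nu}J_{\nu+2r+2}(2z)$$ uniformly on compact subsets of $\mathbb{C}$.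
   Context: All moments of $\mu$ are finite. Orthonormal polynomials are normalized with positive leading coefficients, the $n$-th one having exact degree $n$. The notation $x_n\cong y_n$ means $x_n/y_n\to1$ as $n\to\infty$. $J_\nu(z)=\sum_{n=0}^\infty\frac{(-1)^n}{n!\,\Gamma(n+\nu+1)}\left(\frac z2\right)^{2n+\nu}$ is the Bessel function of order $\nu>-1$; the expressions $z^{-\nu}J_{\nu+m}(2z)=\sum_{n\ge0}\frac{(-1)^n z^{2n+m}}{n!\,\Gamma(n+\nu+m+1)}$ ($m\ge0$ an integer) are understood as entire functions of $z$. *)

(* Defs.v *)
From HB Require Import structures.
From mathcomp Require Import all_boot all_order all_algebra.
From mathcomp Require Import all_classical all_reals all_analysis.
From mathcomp Require Import complex.

Set Implicit Arguments.
Unset Strict Implicit.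
Unset Printing Implicit Defensive.

Import Order.TTheory GRing.Theory Num.Theory.
Import numFieldNormedType.Exports.

Local Open Scope classical_set_scope.
Local Open Scope ring_scope.
Local Open Scope complex_scope.

Definition asym_equiv (R : realType) (x y : nat -> R) : Prop :=
  x n / y n @[n --> \oo] --> (1 : R).

(* The (closed) topological support of a Borel measure on the line. *)
Definition msupport (R : realType)
    (mu : {measure set (measurableTypeR R) -> \bar R}) : set R :=
  [set x | forall U : set R, open U -> U x -> (0 < mu U)%E].

(* Inner product of L^2((x - c)^(2j) dmu), with the density inside the
   integral. *)
Definition weighted_ip (R : realType)
    (mu : {measure set (measurableTypeR R) -> \bar R}) (c : R) (j : nat)
    (f g : {poly R}) : R :=
  \int[mu]_x (f.[x] * g.[x] * (x - c) ^+ (2 * j)).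

Definition sobolev_ip (R : realType)
    (mu : {measure set (measurableTypeR R) -> \bar R}) (c : R) (r : nat)
    (M : 'I_r.+1 -> R) (f g : {poly R}) : R :=
  \int[mu]_x (f.[x] * g.[x])
  + \sum_(i < r.+1) M i * (derivn i f).[c] * (derivn i g).[c].

(* [size (p n) = n.+1] says that [p n] has exact degree [n]. *)
Definition orthonormal_polys (R : realType)
    (ip : {poly R} -> {poly R} -> R) (p : nat -> {poly R}) : Prop :=
  [/\ forall n, size (p n) = n.+1,
      forall n, 0 < lead_coef (p n) &
      forall m n, ip (p m) (p n) = (m == n)%:R].

(* Evaluation of a real polynomial at a complex point. *)
Definition chorner (R : realType) (p : {poly R}) (z : R[i]) : R[i] :=
  (map_poly (real_complex R) p).[z].

(* Euler's integral; used only at arguments [s > 0], where it converges. *)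
Definition Gamma (R : realType) (s : R) : R :=
  \int[lebesgue_measure]_(t in `]0, +oo[) (t `^ (s - 1) * expR (- t)).

(* [besselE nu m] is the entire function z |-> z^(-nu) J_(nu+m)(2z), given by
   sum_k (-1)^k z^(2k+m) / (k! Gamma(k+nu+m+1)); this form avoids the
   multivalued power z^(-nu). The type [R[i]^o] is [R[i]] equipped with the
   topology of its modulus. *)
Definition besselE (R : realType) (nu : R) (m : nat) (z : R[i]) : R[i] :=
  limn (series (fun k : nat =>
    ((-1) ^+ k * z ^+ (2 * k + m)
     / (k`!%:R * (Gamma (k%:R + nu + m%:R + 1))%:C) : R[i]^o))).

(* Uniform convergence on the compact subsets of the complex plane. *)
Definition cvg_unif_compacts (R : realType)
    (F : nat -> R[i] -> R[i]) (f : R[i] -> R[i]) : Prop :=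
  {family compact, (F : nat -> R[i]^o -> R[i]^o) @ \oo
                     --> (f : R[i]^o -> R[i]^o)}.

(* Main.v *)
Require Import Defs.
From HB Require Import structures.
From mathcomp Require Import all_boot all_order all_algebra.
From mathcomp Require Import cyclic separable cyclotomic.
From mathcomp Require Import all_classical all_reals all_analysis.
From mathcomp Require Import measurable_realfun complex.
From mathcomp Require Import ring lra.

(* Write p_n for p_n^{[0]}.  Expanding q_n in the p_k gives
     q_n = g p_n - sum_i M_i q_n^(i)(c) sum_(k < n) p_k^(i)(c) p_k,
   so everything reduces to the Mehler-Heine limit of p_n alone.  By Cauchy's
   estimate on circles, locally uniform convergence of the scaled polynomials
   amounts to convergence of their Taylor coefficients at c together with
   bounds O(rho^-m) for every rho > 0.  Let f_m be the limit coefficients of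
   p_n.  By the Stolz-Cesaro theorem the scaled kernel derivatives
   sum_(k < n) p_k^(i)(c) p_k^(m)(c) tend to f_i f_m / (b (nu + 1 + i + m)):
   the linear system for the q_n^(i)(c) becomes a Cauchy system, whose solution
   w satisfies 1 - sum_j w_j / (nu + 1 + m + j)
     = prod_(i <= r) (m - i) / (m + nu + 1 + i).
   This rational function times f_m is the m-th coefficient of
   (-1)^(r+1) z^(-nu) J_(nu+2r+2)(2z), by the functional equation of Gamma. *)

Set Implicit Arguments.
Unset Strict Implicit.
Unset Printing Implicit Defensive.

Import Order.TTheory GRing.Theory Num.Theory.
Import numFieldNormedType.Exports.
Import ComplexField.Normc.

Local Open Scope classical_set_scope.
Local Open Scope ring_scope.
Local Open Scope complex_scope.

(** * The Gamma function *)

(** The masses leave no trace in the limit: each [M i] enters the linear system only through a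
    diagonal term proportional to [kernel_weight s b (2 * i) n], which tends to 0. What remains is a
    Cauchy matrix with rows and columns scaled by the f_i, invertible because no f_i vanishes. The
    relation 2a + 1 = b (nu + 1) turns the growth exponent 1 + 2a + b e of the kernel sums into b
    (nu + 1 + e), hence the Cauchy form. The factor g tends to 1 because the normalization of q_n
    reads g^2 (1 + O(1/n)) = 1 with g > 0. The delicate point is a bound on the coefficients of q_n
    that is uniform in their order m: b_n need not be monotone, and for k < n the ratios (b_k /
    b_n)^m are controlled only by 4^m. Since the Cauchy bounds for p_n hold at every radius,
    enlarging the radius absorbs this factor. *)

Lemma powR_continuous_gt0 (R : realType) (s x : R) : 0 < x ->
  {for x, continuous (fun t : R => t `^ s)}.
Proof.
move=> x0; apply/differentiable_continuous/derivable1_diffP.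
by apply: derivable_powR; rewrite in_itv/= x0.
Qed.

Lemma continuous_gammafun_gt0 (R : realType) (s x : R) : 0 < x ->
  {for x, continuous (fun t : R => t `^ s * expR (- t))}.
Proof.
move=> x0; apply: (@continuousM R R^o).
  exact: powR_continuous_gt0.
apply: (@continuous_comp R R^o R^o -%R expR).
  exact: (@continuousN R R^o).
exact: continuous_expR.
Qed.

Lemma within_itv_gt0_continuous (R : realType) (f : R -> R) (x y : R) :
  0 < x -> (forall t, 0 < t -> {for t, continuous f}) ->
  {within `[x, y], continuous f}.
Proof.
move=> x0 cf; apply: continuous_in_subspaceT => t.
by rewrite inE/= in_itv/= => /andP[xt _]; apply: cf; exact: lt_le_trans xt.
Qed.

Lemma is_derive_expRN (R : realType) (x : R) :
  is_derive x (1 : R) (fun t : R => expR (- t)) (- expR (- x)).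
Proof.
have := is_derive1_comp (is_derive_expR (- x)) (is_deriveNid x (1 : R)).
by rewrite mulrN1.
Qed.

Lemma continuous_expRN (R : realType) : continuous (fun t : R => expR (- t)).
Proof.
move=> t; have [d _] := is_derive_expRN t.
exact/differentiable_continuous/derivable1_diffP.
Qed.

(** The interval stays away from 0, where the integrand is singular for [s < 1]; the boundary terms
    disappear in the limit taken in [gamma_intS]. *)
Lemma gammafun_by_parts (R : realType) (s x y : R) : 0 < x -> x < y ->
  s * \int[lebesgue_measure]_(t in `[x, y]) (t `^ (s - 1) * expR (- t)) =
  \int[lebesgue_measure]_(t in `[x, y]) (t `^ s * expR (- t))
    + (y `^ s * expR (- y) - x `^ s * expR (- x)).
Proof.
move=> x0 xy.
have y0 : 0 < y by exact: lt_trans xy.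
have cN := @continuous_expRN R.
have int u : lebesgue_measure.-integrable `[x, y]
    (EFin \o (fun t : R => t `^ u * expR (- t))).
  apply: continuous_compact_integrable; first exact: segment_compact.
  by apply: within_itv_gt0_continuous => // t; exact: continuous_gammafun_gt0.
have := @Rintegration_by_parts R (fun t => t `^ s) (fun t => expR (- t))
  (fun t => s * t `^ (s - 1)) (fun t => - expR (- t)) x y xy.
have -> : \int[lebesgue_measure]_(t in `[x, y]) (t `^ s * - expR (- t)) =
  - (\int[lebesgue_measure]_(t in `[x, y]) (t `^ s * expR (- t))).
  under eq_Rintegral do rewrite mulrN -mulN1r.
  by rewrite RintegralZl ?mulN1r//; exact: int.
have -> : \int[lebesgue_measure]_(t in `[x, y]) (s * t `^ (s - 1) * expR (- t))
  = s * \int[lebesgue_measure]_(t in `[x, y]) (t `^ (s - 1) * expR (- t)).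
  under eq_Rintegral do rewrite -mulrA.
  by rewrite RintegralZl//; exact: int.
move=> H; suff : - (\int[lebesgue_measure]_(t in `[x, y])
  (t `^ s * expR (- t))) =
  y `^ s * expR (- y) - x `^ s * expR (- x) -
  s * \int[lebesgue_measure]_(t in `[x, y]) (t `^ (s - 1) * expR (- t)) by lra.
apply: H.
- apply: within_itv_gt0_continuous => // t t0.
  apply: (@continuousM R R^o); first exact: cst_continuous.
  exact: powR_continuous_gt0.
- split.
  + move=> t; rewrite in_itv/= => /andP[xt _].
    by apply: derivable_powR; rewrite in_itv/= (lt_trans x0).
  + by apply: cvg_at_right_filter; exact: powR_continuous_gt0.
  + by apply: cvg_at_left_filter; exact: powR_continuous_gt0.
- move=> t; rewrite in_itv/= => /andP[xt _].
  by rewrite powR_derive1// in_itv/= (lt_trans x0).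
- apply: within_itv_gt0_continuous => // t _.
  by apply: (@continuousN R R^o); exact: cN.
- split.
  + by move=> t _; have [] := is_derive_expRN t.
  + by apply: cvg_at_right_filter; exact: cN.
  + by apply: cvg_at_left_filter; exact: cN.
- by move=> t _; rewrite derive1E; have [_ ->] := is_derive_expRN t.
Qed.

(** Extended-real form of [Gamma]: monotone convergence and the functional equation are available
    here before finiteness is known. *)
Definition gamma_int (R : realType) (s : R) : \bar R :=
  (\int[lebesgue_measure]_(t in `]0%R, +oo[) (t `^ (s - 1) * expR (- t))%:E)%E.

Lemma powR_expRN_cvg0 (R : realType) (s : R) :
  n.+2%:R `^ s * expR (- n.+2%:R) @[n --> \oo] --> (0 : R).
Proof.
pose k := (Num.truncn `|s|).+1.
(* An integer exponent above [s] suffices: e^t >= t^(k+1) / (k+1)! leaves a decay of order 1/t for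
   t^k e^(-t). *)
have sk : s <= k%:R.
  by rewrite (le_trans (ler_norm _))// ltW// /k truncnS_gt.
apply: (@squeeze_cvgr _ _ _ _ (fun=> 0) (fun n => k.+1`!%:R * n.+1%:R^-1)).
- near=> n; apply/andP; split; first by rewrite mulr_ge0 ?powR_ge0 ?expR_ge0.
  have n0 : (0 : R) < n.+2%:R by rewrite ltr0n.
  apply: (@le_trans _ _ (n.+2%:R ^+ k * expR (- n.+2%:R))).
    rewrite ler_wpM2r ?expR_ge0// -powR_mulrn//.
    by apply: ler_powR; rewrite ?ler1n.
  rewrite expRN ler_pdivrMr ?expR_gt0//.
  have := @expR_ge1Dxn R n.+2%:R k (ltW n0).
  have f0 : (0 : R) < k.+1`!%:R by rewrite ltr0n fact_gt0.
  move=> H; have {}H : n.+2%:R ^+ k.+1 / k.+1`!%:R <= expR n.+2%:R :> R by lra.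
  rewrite ler_pdivrMr// in H.
  rewrite -mulrA (mulrC n.+1%:R^-1) mulrA ler_pdivlMr ?ltr0n//.
  apply: (@le_trans _ _ (n.+2%:R ^+ k.+1)); last by rewrite mulrC.
  by rewrite exprSr ler_wpM2l ?exprn_ge0 ?ler_nat.
- exact: cvg_cst.
- rewrite -[X in _ --> X](mulr0 k.+1`!%:R).
  apply: cvgM; first exact: cvg_cst.
  exact: cvg_harmonic.
Unshelve. all: by end_near. Qed.

Lemma powR_expRN0_cvg0 (R : realType) (s : R) : 0 < s ->
  n.+1%:R^-1 `^ s * expR (- n.+1%:R^-1) @[n --> \oo] --> (0 : R).
Proof.
move=> s0.
apply: (@squeeze_cvgr _ _ _ _ (fun=> 0) (fun n => n.+1%:R^-1 `^ s)).
- near=> n; rewrite mulr_ge0 ?powR_ge0 ?expR_ge0//=.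
  by rewrite ler_piMr ?powR_ge0// expR_le1 oppr_le0 invr_ge0.
- exact: cvg_cst.
- have := @powR_cvg0 R s s0; move/cvg_at_rightP; apply; split.
    by move=> n; rewrite invr_gt0.
  exact: cvg_harmonic.
Unshelve. all: by end_near. Qed.

Lemma gammafun_measurable (R : realType) (s : R)
    (D : set (measurableTypeR R)) :
  measurable D ->
  measurable_fun D (fun t : measurableTypeR R => t `^ s * expR (- t)).
Proof.
move=> mD; apply: measurable_funTS.
apply: measurable_funM; first exact: measurable_powR.
by apply: measurableT_comp => //; exact: measurable_funN.
Qed.

(** Monotone convergence along an exhaustion; the right endpoint n + 2 keeps the interval
    nondegenerate at n = 0, as integration by parts requires. *)
Lemma gamma_int_cvg (R : realType) (s : R) :
  (\int[lebesgue_measure]_(t in `[n.+1%:R^-1, n.+2%:R])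
     (t `^ (s - 1) * expR (- t)))%:E @[n --> \oo] --> gamma_int s.
Proof.
rewrite /gamma_int.
have -> : `]0, +oo[%classic = \bigcup_n `[(n.+1%:R^-1 : R), n.+2%:R]%classic.
  apply/seteqP; split => [t/=|t [n _]/=]; rewrite !in_itv/=.
    rewrite andbT => t0; pose k := Num.truncn (t + t^-1).
    have kt : t + t^-1 < k.+1%:R by rewrite /k truncnS_gt.
    have ti : 0 < t^-1 by rewrite invr_gt0.
    exists k => //=; rewrite in_itv/=; apply/andP; split.
      by rewrite -[leRHS]invrK lef_pV2 ?posrE ?ltr0n//; lra.
    by rewrite -[k.+2%:R]natr1; lra.
  by move=> /andP[nt _]; rewrite andbT (lt_le_trans _ nt)// invr_gt0.
have int n : lebesgue_measure.-integrable `[(n.+1%:R^-1 : R), n.+2%:R]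
    (fun t : R => (t `^ (s - 1) * expR (- t))%:E).
  apply: continuous_compact_integrable; first exact: segment_compact.
  apply: within_itv_gt0_continuous => [|t]; first by rewrite invr_gt0.
  exact: continuous_gammafun_gt0.
under eq_cvg.
  move=> n; rewrite /Rintegral fineK; last exact: integrable_fin_num (int n).
  over.
apply: ge0_nondecreasing_set_cvg_integral => //.
- move=> n m nm; apply/subsetPset; apply: subset_itv; rewrite bnd_simp.
    by rewrite lef_pV2 ?posrE ?ltr0n// ler_nat ltnS.
  by rewrite ler_nat !ltnS.
- by move=> n; apply/measurable_EFinP; exact: gammafun_measurable.
- by move=> n t _; rewrite lee_fin mulr_ge0 ?powR_ge0 ?expR_ge0.
Qed.

Lemma gamma_intS (R : realType) (s : R) : 0 < s ->
  gamma_int (s + 1) = (s%:E * gamma_int s)%E.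
Proof.
move=> s0; have h1 := @gamma_int_cvg R (s + 1); have h0 := @gamma_int_cvg R s.
rewrite addrK in h1.
have h2 : (n.+2%:R `^ s * expR (- n.+2%:R)
    - n.+1%:R^-1 `^ s * expR (- n.+1%:R^-1))%:E @[n --> \oo] --> (0%E : \bar R).
  apply: cvg_EFin; first exact: nearW.
  rewrite -[X in _ --> X](subr0 0).
  by apply: cvgB; [exact: powR_expRN_cvg0|exact: powR_expRN0_cvg0].
have h3 := @cvgeD _ \oo eventually_filter R _ _ _ _ 
  (fin_num_adde_defl _ (isT : 0%E \is a fin_num)) h1 h2.
have h4 := @cvgeZl _ _ _ _ _ s%:E isT h0.
rewrite adde0 in h3.
rewrite -(cvg_lim _ h3)//; apply: cvg_lim => //.
move: h4; apply: cvg_trans.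
apply: near_eq_cvg; near=> n; rewrite /= -EFinM -EFinD; congr EFin.
rewrite gammafun_by_parts ?invr_gt0//.
by rewrite (@le_lt_trans _ _ 1)// ?ltr1n// invf_le1 ?ltr0n// ler1n.
Unshelve. all: by end_near. Qed.

Lemma gamma_int_ge0 (R : realType) (s : R) : (0 <= gamma_int s)%E.
Proof.
by apply: integral_ge0 => t _; rewrite lee_fin mulr_ge0 ?powR_ge0 ?expR_ge0.
Qed.

Lemma gamma_int1 (R : realType) : gamma_int (1 : R) = 1%E.
Proof.
have cN := @continuous_expRN R.
rewrite /gamma_int subrr; under eq_integral do rewrite powRr0 mul1r.
rewrite integral_itv_obnd_cbnd; last first.
  apply/measurable_EFinP; apply: measurable_funTS.
  by apply: measurableT_comp => //; exact: measurable_funN.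
rewrite (@ge0_continuous_FTC2y _ _ (fun t => - expR (- t)) _ 0).
- by rewrite oppr0 expR0 EFinN oppeK add0e.
- by move=> x _; exact: expR_ge0.
- by apply: continuous_subspaceT => t; exact: cN.
- by rewrite -oppr0; apply: cvgN; exact: cvgr_expR.
- by move=> x _; apply: derivableN; have [] := is_derive_expRN x.
- by apply: cvgN; apply: cvg_at_right_filter; exact: cN.
- move=> x _; rewrite derive1E deriveN; have [d e] := is_derive_expRN x => //.
  by rewrite e opprK.
Qed.

Lemma gamma_int_nat (R : realType) (n : nat) :
  (gamma_int (n.+1%:R : R) < +oo)%E.
Proof.
elim: n => [|n IH]; first by rewrite gamma_int1 ltry.
rewrite -natr1 gamma_intS ?ltr0n//.
by rewrite -(@fineK _ (gamma_int _)) ?ltry// ge0_fin_numE ?gamma_int_ge0.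
Qed.

(** The functional equation moves the question to [s + 1], away from the singularity at 0; there t^s
    <= 1 + t^k, for an integer k >= s, reduces it to integer arguments. *)
Lemma gamma_int_fin (R : realType) (s : R) : 0 < s -> gamma_int s \is a fin_num.
Proof.
move=> s0; rewrite ge0_fin_numE ?gamma_int_ge0//.
suff : (gamma_int (s + 1) < +oo)%E.
  rewrite gamma_intS//; have := gamma_int_ge0 s.
  by case: (gamma_int s) => [r _ _|_|//]; rewrite ?ltry// gt0_muley.
pose k := (Num.truncn s).+1.
have sk : s <= k%:R by rewrite ltW// /k truncnS_gt.
apply: (@le_lt_trans _ _ (gamma_int 1 + gamma_int (k.+1%:R : R))%E); last first.
  apply: lte_add_pinfty; last exact: gamma_int_nat.
  by rewrite gamma_int1; exact: ltry.
rewrite /gamma_int -ge0_integralD//.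
- apply: ge0_le_integral => //.
  + by move=> t _; rewrite lee_fin mulr_ge0 ?powR_ge0 ?expR_ge0.
  + by apply/measurable_EFinP; exact: gammafun_measurable.
  + by apply/emeasurable_funD; apply/measurable_EFinP;
    exact: gammafun_measurable.
  + move=> t; rewrite /= in_itv/= andbT => t0.
    rewrite -EFinD lee_fin -mulrDl ler_wpM2r ?expR_ge0//.
    rewrite subrr powRr0 addrK -natr1 addrK.
    have [t1|t1] := leP 1 t.
      by rewrite (@le_trans _ _ (t `^ k%:R)) ?lerDr//; exact: ler_powR.
    rewrite (@le_trans _ _ 1) ?lerDl ?powR_ge0//.
    have := ge0_ler_powR (ltW s0) (x := t) (y := 1).
    by rewrite powR1; apply; rewrite ?nnegrE ?ltW.
- by move=> t _; rewrite lee_fin mulr_ge0 ?powR_ge0 ?expR_ge0.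
- by apply/measurable_EFinP; exact: gammafun_measurable.
- by move=> t _; rewrite lee_fin mulr_ge0 ?powR_ge0 ?expR_ge0.
- by apply/measurable_EFinP; exact: gammafun_measurable.
Qed.

Lemma GammaE (R : realType) (s : R) : 0 < s -> (Gamma s)%:E = gamma_int s.
Proof. by move=> s0; rewrite /Gamma /Rintegral fineK// gamma_int_fin. Qed.

Lemma GammaS (R : realType) (s : R) : 0 < s -> Gamma (s + 1) = s * Gamma s.
Proof.
move=> s0; apply: EFin_inj.
by rewrite EFinM !GammaE ?gamma_intS ?addr_gt0.
Qed.

(** A zero integral would make the nonnegative integrand vanish almost everywhere, but it is
    positive on []0, 1[], a set of measure 1. *)
Lemma Gamma_gt0 (R : realType) (s : R) : 0 < s -> 0 < Gamma s.
Proof.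
move=> s0; rewrite -lte_fin GammaE// lt0e gamma_int_ge0 andbT.
apply/eqP => G0.
have mg : measurable_fun (`]0, +oo[%classic : set (measurableTypeR R))
    (EFin \o (fun t : measurableTypeR R => t `^ (s - 1) * expR (- t))).
  by apply/measurable_EFinP; exact: gammafun_measurable.
have := (ae_eq_integral_abs lebesgue_measure (measurable_itv _) mg).1.
have -> : (\int[lebesgue_measure]_(x in `]0%R, +oo[)
    `|(EFin \o (fun t => (t `^ (s - 1) * expR (- t))%R)) x| = 0)%E.
  rewrite -[RHS]G0; apply: eq_integral => t _.
  by rewrite /= ger0_norm// mulr_ge0 ?powR_ge0 ?expR_ge0.
move=> /(_ erefl) [N [mN N0 sub]].
have : (lebesgue_measure (`]0%R, 1%R[%classic : set R) <= 0 :> \bar R)%E.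
  rewrite -N0; apply: le_measure; rewrite ?inE//.
  apply: subset_trans sub => t /=; rewrite in_itv/= => /andP[t0 t1] /(_ _)/eqP.
  rewrite in_itv/= t0 eqe mulf_eq0 => /(_ isT).
  by rewrite gt_eqF ?powR_gt0// gt_eqF ?expR_gt0.
by rewrite lebesgue_measure_itv/= lte_fin ltr01 oppr0 adde0 lee_fin leNgt ltr01.
Qed.

(** * Complex modulus and the Cauchy estimate *)

Lemma normr_normc (R : rcfType) (z : R[i]) : `|z| = (normc z)%:C.
Proof. by []. Qed.

Lemma normc_ge0 (R : rcfType) (z : R[i]) : 0 <= normc z.
Proof. by case: z => a b /=; exact: sqrtr_ge0. Qed.

Lemma normcR (R : rcfType) (x : R) : normc x%:C = `|x|.
Proof. by rewrite /= expr0n addr0 sqrtr_sqr. Qed.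

Lemma normcX (R : rcfType) (z : R[i]) n : normc (z ^+ n) = normc z ^+ n.
Proof.
by elim: n => [|n IH]; rewrite ?expr0 ?normc1// !exprS normcM IH.
Qed.

Lemma ler_normc_sum (R : rcfType) (n : nat) (g : nat -> R[i]) :
  normc (\sum_(i < n) g i) <= \sum_(i < n) normc (g i).
Proof.
elim: n => [|n IH]; first by rewrite !big_ord0 normc0.
rewrite !big_ord_recr/=; apply: (le_trans (le_normcD _ _)).
by rewrite lerD2r.
Qed.

Lemma normc_Re (R : rcfType) (z : R[i]) : `|complex.Re z| <= normc z.
Proof. by rewrite -lecR -normr_normc normc_ge_Re. Qed.

Lemma normc_Im (R : rcfType) (z : R[i]) : `|complex.Im z| <= normc z.
Proof.
by case: z => a b /=; rewrite -sqrtr_sqr ler_wsqrtr// lerDr sqr_ge0.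
Qed.

Lemma normc_le_ReIm (R : rcfType) (z : R[i]) :
  normc z <= `|complex.Re z| + `|complex.Im z|.
Proof.
rewrite [z in leLHS]complexE; apply: (le_trans (le_normcD _ _)).
by rewrite normcM !normcR /= expr0n expr1n add0r sqrtr1 mul1r.
Qed.

Lemma prim_root_exists (F : numClosedFieldType) (n : nat) : (0 < n)%N ->
  exists z : F, n.-primitive_root z.
Proof.
move=> n0; have [s Es] := closed_field_poly_normal ('X^n - 1 : {poly F}).
rewrite (monicP _) ?monicXnsubC// scale1r in Es.
suff /hasP[z _ zP] : has n.-primitive_root s by exists z.
apply: has_prim_root => //.
- by apply/allP => z; rewrite -root_prod_XsubC -Es.
- rewrite -separable_prod_XsubC -Es separable_Xn_sub_1//.
  by rewrite pnatr_eq0 -lt0n.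
- by rewrite -ltnS -(size_prod_XsubC s id) -Es size_XnsubC.
Qed.

Lemma sum_unity_root (F : fieldType) (n : nat) (x : F) :
  x ^+ n = 1 -> x != 1 -> \sum_(i < n) x ^+ i = 0.
Proof.
move=> xn x1; have /eqP := subrX1 x n.
by rewrite xn subrr eq_sym mulf_eq0 subr_eq0 (negPf x1) => /eqP.
Qed.

(* Averaging against the N-th roots of unity isolates one coefficient. *)
Lemma cauchy_estimate (R : rcfType) (N k : nat) (g : nat -> R[i]) (rho C : R) :
  0 < rho -> (k < N)%N ->
  (forall z, normc z = rho -> normc (\sum_(i < N) g i * z ^+ i) <= C) ->
  normc (g k) * rho ^+ k <= C.
Proof.
move=> rho0 kN H; have N0 : (0 < N)%N by exact: leq_ltn_trans kN.
have [w wP] := @prim_root_exists R[i] N N0.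
have w1 : w ^+ N = 1 by exact: prim_expr_order wP.
have w0 : w != 0.
  by apply/eqP => e; move/eqP: w1; rewrite e expr0n gtn_eqF// eq_sym oner_eq0.
have nw : normc w = 1.
  apply/eqP; rewrite -(@pexpr_eq1 _ _ N) ?normc_ge0//.
  by rewrite -normcX w1 normc1.
have avg : \sum_(l < N) (w ^+ k) ^- l *
    (\sum_(i < N) g i * (rho%:C * w ^+ l) ^+ i) =
    N%:R * (g k * rho%:C ^+ k).
  under eq_bigr do rewrite mulr_sumr.
  rewrite exchange_big/= (bigD1 (Ordinal kN))//= [X in _ + X]big1 => [|i ik].
    rewrite addr0 -[N in N%:R]card_ord -sumr_const mulr_suml.
    apply: eq_bigr => l _.
    rewrite mul1r exprMn mulrCA; congr (g k * _).
    rewrite mulrCA -exprM -exprM mulnC mulVf ?mulr1//.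
    by rewrite expf_neq0.
  have -> : \sum_(l < N) (w ^+ k) ^- l * (g i * (rho%:C * w ^+ l) ^+ i) =
      g i * rho%:C ^+ i * \sum_(l < N) (w ^+ i / w ^+ k) ^+ l.
    rewrite mulr_sumr; apply: eq_bigr => l _.
    rewrite !exprMn exprVn -!exprM [(l * i)%N]mulnC.
    by move: (_ ^- _) => x; ring.
  rewrite sum_unity_root ?mulr0//.
    by rewrite exprMn exprVn -!exprM ![(_ * N)%N]mulnC !exprM w1 !expr1n divr1.
  apply/eqP => e; have /eqP : w ^+ i = w ^+ k.
    by rewrite -[LHS](divfK (expf_neq0 k w0)) e mul1r.
  rewrite (eq_prim_root_expr wP) !modn_small// => /eqP e'.
  by move/eqP : ik; apply; apply/val_inj.
have NR : (0 : R) < N%:R by rewrite ltr0n.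
rewrite -(ler_pM2l NR).
have <- : normc (N%:R * (g k * rho%:C ^+ k)) = N%:R * (normc (g k) * rho ^+ k).
  rewrite !normcM normcX normcR (gtr0_norm rho0).
  by rewrite -(rmorph_nat (real_complex R)) normcR ger0_norm.
rewrite -avg.
apply: (le_trans (@ler_normc_sum _ _ (fun l => (w ^+ k) ^- l *
    (\sum_(i < N) g i * (rho%:C * w ^+ l) ^+ i)))).
rewrite -[N in N%:R]card_ord -sumr_const mulr_suml; apply: ler_sum => l _.
rewrite mul1r normcM normcV !normcX nw !expr1n invr1 mul1r.
by apply: H; rewrite normcM normcX nw expr1n mulr1 normcR gtr0_norm.
Qed.

Lemma cvg_complex (R : realType) (u : nat -> R[i]) (L : R[i]) :
  complex.Re (u n) @[n --> \oo] --> complex.Re L ->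
  complex.Im (u n) @[n --> \oo] --> complex.Im L ->
  (u n : R[i]^o) @[n --> \oo] --> (L : R[i]^o).
Proof.
move=> /cvgrPdist_lt ur /cvgrPdist_lt ui; apply/cvgrPdist_lt => -[e e'].
rewrite ltcE/= => /andP[/eqP -> e0]; have e20 : 0 < e / 2 by rewrite divr_gt0.
near=> n; rewrite normr_normc ltcR.
apply: (le_lt_trans (normc_le_ReIm _)); rewrite (splitr e) !raddfB.
by apply: ltrD; near: n; [exact: ur|exact: ui].
Unshelve. all: by end_near. Qed.

Lemma sum_tail_le (R : rcfType) (g : nat -> R[i]) (C : R) (m n : nat) :
  (forall k, normc (g k) <= C / 2 ^+ k) -> (m <= n)%N ->
  normc (\sum_(i < n) g i - \sum_(i < m) g i) <= 2 * C / 2 ^+ m.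
Proof.
move=> gC mn; have C0 : 0 <= C.
  by have := le_trans (normc_ge0 _) (gC 0%N); rewrite expr0 divr1.
(* The subtracted term makes the geometric bound telescope, so that the induction closes. *)
suff H k : normc (\sum_(i < m + k) g i - \sum_(i < m) g i) <=
    2 * C / 2 ^+ m - 2 * C / 2 ^+ (m + k).
  rewrite -(subnKC mn); apply: le_trans (H _) _.
  by rewrite gerBl divr_ge0 ?mulr_ge0 ?exprn_ge0.
elim: k => [|k IH]; first by rewrite addn0 !subrr normc0.
rewrite addnS big_ord_recr/= addrAC; apply: le_trans (le_normcD _ _) _.
have := gC (m + k)%N; rewrite exprS invfM.
set a := (2 ^+ (m + k))^-1; move: IH; rewrite -/a.
by set b := 2 * C / 2 ^+ m; lra.
Qed.

Lemma complex_series_cvg (R : realType) (g : nat -> R[i]) (C : R) :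
  (forall k, normc (g k) <= C / 2 ^+ k) ->
  let L := limn (series (g : nat -> R[i]^o)) in
  (series (g : nat -> R[i]^o) @ \oo --> (L : R[i]^o)) /\
  forall m, normc (L - \sum_(i < m) g i) <= 2 * C / 2 ^+ m.
Proof.
move=> gC L; have C0 : 0 <= C.
  by have := le_trans (normc_ge0 _) (gC 0%N); rewrite expr0 divr1.
have real_cvg (h : nat -> R) : (forall k, `|h k| <= C / 2 ^+ k) ->
    series h @ \oo --> limn (series h).
  move=> hC; apply: normed_cvg.
  apply: (@series_le_cvg _ _ (geometric C 2^-1)) => //=.
  - by move=> k; rewrite mulr_ge0 ?exprn_ge0.
  - by move=> k; rewrite exprVn.
  - apply: is_cvg_geometric_series.
    by rewrite ger0_norm ?invr_ge0// invf_lt1 ?ltr1n.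
have cr := real_cvg (fun k => complex.Re (g k))
  (fun k => le_trans (normc_Re _) (gC k)).
have ci := real_cvg (fun k => complex.Im (g k))
  (fun k => le_trans (normc_Im _) (gC k)).
have cg : series (g : nat -> R[i]^o) @ \oo --> (L : R[i]^o).
  apply/cvg_ex.
  exists (limn (series (fun k => complex.Re (g k)))
          +i* limn (series (fun k => complex.Im (g k)))).
  apply: cvg_complex; rewrite /=.
    by move: cr; under eq_cvg do rewrite /series/= -raddf_sum.
  by move: ci; under eq_cvg do rewrite /series/= -raddf_sum.
split=> // m; apply/ler_addgt0Pr => e e0.
have /cvgrPdist_lt/(_ e%:C) := cg; rewrite ltcR => /(_ e0)[n _ nP].
have {nP} := nP (maxn n m) (leq_maxl _ _); rewrite normr_normc ltcR => /ltW.
rewrite /series/= big_mkord => H.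
rewrite -(subrK (\sum_(i < maxn n m) g i) L) -addrA.
apply: (le_trans (le_normcD _ _)); rewrite [leRHS]addrC; apply: lerD => //.
exact: sum_tail_le gC (leq_maxr _ _).
Qed.

(** * Uniform convergence on compact sets in terms of the modulus *)

Lemma cvg_unif_compactsP (R : realType) (F : nat -> R[i] -> R[i])
    (f : R[i] -> R[i]) :
  cvg_unif_compacts F f <-> forall K : set R[i]^o, compact K ->
    forall e : R, 0 < e ->
    \forall n \near \oo, forall z, K z -> normc (f z - F n z) < e.
Proof.
rewrite /cvg_unif_compacts; split => [/fam_cvgP H K cK e e0|H].
  have := H K cK; set P := [set h : R[i]^o -> R[i]^o |
    forall z, K z -> normc (f z - h z) < e] => HK.
  have : nbhs (f : {uniform` K -> R[i]^o}) P.
    apply/uniform_nbhs; exists [set xy | ball xy.1 (e%:C) xy.2]; split.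
      by rewrite -entourage_from_ballE; exists e%:C => //=; rewrite ltcR.
    move=> h /= hP z /hP; rewrite -ball_normE/= normr_normc ltcR; exact.
  by move=> /HK.
apply/fam_cvgP => K cK P /uniform_nbhs[E [+ EP]].
rewrite -entourage_from_ballE => -[[e e'] /=].
rewrite ltcE/= => /andP[/eqP -> e0] eE.
have := H K cK e e0; apply: filterS => n nP; apply: EP => z /= /nP zP.
by apply: eE => /=; rewrite -ball_normE/= normr_normc ltcR.
Qed.

Lemma continuous_normc (R : realType) :
  continuous (normc (R := R) : R[i]^o -> R).
Proof.
move=> z; apply/(@cvgrPdist_lt _ _ _ (nbhs (z : R[i]^o))) => e e0.
have eC : 0 < e%:C by rewrite ltcR.
have := @nbhsx_ballx _ R[i]^o z _ eC.
apply: filterS => t; rewrite -ball_normE/= normr_normc ltcR; apply: le_lt_trans.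
have h1 := le_normcD (z - t) t; have h2 := le_normcD (t - z) z.
rewrite !subrK in h1 h2; rewrite -(normcN (t - z)) opprB in h2.
by rewrite ler_norml; apply/andP; split; lra.
Qed.

Lemma compact_normc_bounded (R : realType) (K : set R[i]^o) :
  compact K -> exists2 rho : R, 0 < rho & forall z, K z -> normc z <= rho.
Proof.
move=> cK.
have : compact (normc (R := R) @` K).
  by apply: continuous_compact => //;
    exact/continuous_subspaceT/continuous_normc.
move=> /(@compact_bounded R R^o) [M [_ MP]].
exists (`|M| + 1) => [|z Kz]; first by rewrite ltr_wpDl.
have := MP (`|M| + 1); rewrite (le_lt_trans (ler_norm _)) ?ltrDl// => /(_ isT).
move=> /(_ (normc z)) /=; rewrite ger0_norm ?normc_ge0//; apply.
by exists z.
Qed.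

(* A square rather than the disc: it is compact as an image of a product. *)
Lemma compact_square (R : realType) (rho : R) : exists2 K : set R[i]^o,
  compact K & forall z, normc z <= rho -> K z.
Proof.
pose h (xy : R * R) : R[i]^o := xy.1 +i* xy.2.
exists (h @` (`[- rho, rho] `*` `[- rho, rho])); last first.
  move=> [x y] xy; exists (x, y) => //=; rewrite !in_itv/= -!ler_norml.
  split; first exact: le_trans (normc_Re (x +i* y)) xy.
  exact: le_trans (normc_Im (x +i* y)) xy.
apply: continuous_compact; last by apply: compact_setX; exact: segment_compact.
apply: continuous_subspaceT => -[x y]; apply/cvgrPdist_lt => -[e e'].
rewrite ltcE/= => /andP[/eqP -> e0]; have e20 : 0 < e / 2 by rewrite divr_gt0.
have /cvgrPdist_lt/(_ _ e20) nx : (fun t : R * R => t.1) @ (x, y) --> x.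
  exact: cvg_fst.
have /cvgrPdist_lt/(_ _ e20) ny : (fun t : R * R => t.2) @ (x, y) --> y.
  exact: cvg_snd.
near=> t; rewrite /h normr_normc ltcR.
apply: (le_lt_trans (normc_le_ReIm _)); rewrite (splitr e) !raddfB/=.
by apply: ltrD; near: t.
Unshelve. all: by end_near. Qed.

(** * Locally uniform convergence and Taylor coefficients *)

(** Infinite radius of convergence, encoded as Cauchy estimates at every radius. *)
Definition entire_coefs (R : realType) (f : nat -> R) :=
  forall rho : R, 0 < rho -> exists C, forall i, `|f i| * rho ^+ i <= C.

Definition even_series (R : realType) (f : nat -> R) (z : R[i]) : R[i] :=
  limn (series (fun k => (f k)%:C * z ^+ (2 * k) : R[i]^o)).

Lemma cvg_half_powers (R : realType) (C : R) : C / 2 ^+ n @[n --> \oo] -->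
  (0 : R).
Proof.
have : `|2^-1 : R| < 1 by rewrite ger0_norm ?invr_ge0// invf_lt1 ?ltr1n.
move=> /(@cvg_geometric R C); rewrite /geometric/=.
by under eq_cvg do rewrite exprVn.
Qed.

(** A Cauchy bound at twice the radius gives geometric decay of ratio 1/2 on the original disc;
    radii refer to the variable z^2. *)
Lemma even_term_le (R : realType) (x rho C : R) (z : R[i]) (i : nat) :
  normc z ^+ 2 <= rho -> `|x| * (2 * rho) ^+ i <= C ->
  normc (x%:C * z ^+ (2 * i)) <= C / 2 ^+ i.
Proof.
move=> zrho xC; rewrite normcM normcR normcX exprM.
rewrite ler_pdivlMr ?exprn_gt0//; apply: le_trans xC.
have z2 : 0 <= normc z ^+ 2 by rewrite exprn_ge0 ?normc_ge0.
have H : (normc z ^+ 2) ^+ i <= rho ^+ i.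
  by rewrite lerXn2r ?nnegrE// (le_trans z2).
rewrite [(2 * _) ^+ i]exprMn -mulrA ler_wpM2l// mulrC ler_wpM2l//;
  exact: exprn_ge0.
Qed.

Lemma even_series_tail (R : realType) (f : nat -> R) (rho C : R) (z : R[i]) m :
  normc z ^+ 2 <= rho -> (forall i, `|f i| * (2 * rho) ^+ i <= C) ->
  normc (even_series f z - \sum_(i < m) (f i)%:C * z ^+ (2 * i))
    <= 2 * C / 2 ^+ m.
Proof.
move=> zrho fC; have [_] := @complex_series_cvg R
  (fun i => (f i)%:C * z ^+ (2 * i)) C (fun i => even_term_le zrho (fC i)).
exact.
Qed.

Lemma sum_support (V : nmodType) (u : nat -> V) (m n : nat) : (m <= n)%N ->
  (forall i, (m <= i)%N -> u i = 0) -> \sum_(i < n) u i = \sum_(i < m) u i.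
Proof.
move=> mn u0; rewrite -!(big_mkord xpredT) (@big_cat_nat _ _ _ m 0 n)//=.
by rewrite [X in _ + X = _]big_nat_cond [X in _ + X = _]big1 ?addr0// =>
  i /andP[/andP[/u0]].
Qed.

Lemma sqrtc_circle (R : realType) (w : R[i]) :
  exists2 z : R[i], w = z ^+ 2 & normc z ^+ 2 = normc w.
Proof. by exists (sqrtc w); rewrite -?normcX ?sqr_sqrtc. Qed.

(** Cauchy's estimate in the variable w = z^2 on the circle of radius [rho], for the difference
    between the polynomial and a truncation of the limit series. *)
Lemma unif_coef_diff (R : realType) (c : nat -> nat -> R) (f : nat -> R) :
  (forall n i, (n < i)%N -> c n i = 0) -> entire_coefs f ->
  cvg_unif_compacts (fun n z => \sum_(i < n.+1) (c n i)%:C * z ^+ (2 * i))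
    (even_series f) ->
  forall rho e : R, 0 < rho -> 0 < e ->
    \forall n \near \oo, forall i, `|c n i - f i| * rho ^+ i <= e.
Proof.
move=> c0 fE /cvg_unif_compactsP H rho e rho0 e0.
have e20 : 0 < e / 2 by rewrite divr_gt0.
have [C fC] := fE (2 * rho) (mulr_gt0 (ltr0Sn _ 1) rho0).
have [K cK KP] := @compact_square R (Num.sqrt rho).
have [M _ MP] : \forall m \near \oo, 2 * C / 2 ^+ m <= e / 2.
  have /cvgrPdist_le/(_ _ e20) := @cvg_half_powers R (2 * C).
  by apply: filterS => m; rewrite sub0r normrN; exact/le_trans/ler_norm.
have := H K cK _ e20; apply: filterS => n nP i.
(* [N] has to exceed the degree [n] and the index [i], and to reach [M] so that the discarded tail
   of [f] is at most e/2. *)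
rewrite -normcR; pose N := maxn M (maxn n.+1 i.+1).
apply: (@cauchy_estimate R N i (fun i => (c n i - f i)%:C)) => //.
  by rewrite /N !leq_max leqnn !orbT.
move=> w wrho; have [z zw zn] := sqrtc_circle w.
have -> : \sum_(j < N) (c n j - f j)%:C * w ^+ j =
    - (even_series f z - \sum_(j < n.+1) (c n j)%:C * z ^+ (2 * j)) +
    (even_series f z - \sum_(j < N) (f j)%:C * z ^+ (2 * j)).
  rewrite opprB addrA subrK.
  rewrite -(@sum_support _ (fun j => (c n j)%:C * z ^+ (2 * j)) n.+1 N).
  - rewrite -sumrB; apply: eq_bigr => j _.
    by rewrite zw -exprM -mulrBl rmorphB.
  - by rewrite /N !leq_max leqnn !orbT.
  - by move=> j /c0 ->; rewrite mul0r.
apply: le_trans (le_normcD _ _) _; rewrite normcN (splitr e); apply: lerD.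
  apply/ltW/nP/KP; rewrite -wrho -zn sqrtr_sqr ger0_norm//.
  exact: normc_ge0.
apply: le_trans (MP N _); last by rewrite /N /= leq_maxl.
by apply: even_series_tail fC; rewrite zn wrho.
Qed.

Lemma coef_of_unif (R : realType) (c : nat -> nat -> R) (f : nat -> R) :
  (forall n i, (n < i)%N -> c n i = 0) -> entire_coefs f ->
  cvg_unif_compacts (fun n z => \sum_(i < n.+1) (c n i)%:C * z ^+ (2 * i))
    (even_series f) ->
  (forall i, c n i @[n --> \oo] --> f i) /\
  (forall rho : R, 0 < rho -> exists C, forall n i, `|c n i| * rho ^+ i <= C).
Proof.
move=> c0 fE /(unif_coef_diff c0 fE) H; split=> [i|rho rho0].
  apply/cvgrPdist_le => e e0; have := H 1 e ltr01 e0.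
  by apply: filterS => n /(_ i); rewrite expr1n mulr1 distrC.
have [n0 _ n0P] := H rho 1 rho0 ltr01; have [C fC] := fE rho rho0.
(* Uniform closeness to [f] bounds the coefficients from [n0] on; the sums [S k] take care of the
   finitely many earlier polynomials. *)
pose S k := \sum_(i < k.+1) `|c k i| * rho ^+ i.
have S_ge0 k : 0 <= S k.
  by apply: sumr_ge0 => i _; rewrite mulr_ge0 ?exprn_ge0// ltW.
have C0 : 0 <= C by apply: le_trans (fC 0%N); rewrite expr0 mulr1.
exists (1 + C + \sum_(k < n0) S k) => n i.
have [nn0|nn0] := leqP n0 n.
  rewrite -[leLHS]addr0; apply: lerD; last first.
    by apply: sumr_ge0 => k _; exact: S_ge0.
  have := n0P n nn0 i; have := fC i.
  move=> h1 h2; apply: le_trans (lerD h2 h1).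
  rewrite -mulrDl ler_wpM2r ?exprn_ge0 ?(ltW rho0)//.
  by rewrite -[in leLHS](subrK (f i) (c n i)) ler_normD.
have h : `|c n i| * rho ^+ i <= S n.
  have [ni|/c0 ->] := leqP i n; last by rewrite normr0 mul0r.
  rewrite /S (bigD1 (Ordinal (ni : (i < n.+1)%N)))//= lerDl.
  by apply: sumr_ge0 => j _; rewrite mulr_ge0 ?exprn_ge0// ltW.
apply: (le_trans h); rewrite (bigD1 (Ordinal nn0))//=.
rewrite addrCA lerDl !addr_ge0//; apply: sumr_ge0 => k _; exact: S_ge0.
Qed.

Lemma cvg_sum_ord (R : realType) (n : nat) (u : nat -> nat -> R)
    (l : nat -> R) :
  (forall i, (i < n)%N -> u i k @[k --> \oo] --> l i) ->
  \sum_(i < n) u i k @[k --> \oo] --> \sum_(i < n) l i.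
Proof.
elim: n => [|n IH] H.
  by rewrite big_ord0; under eq_cvg do rewrite big_ord0; exact: cvg_cst.
rewrite big_ord_recr/=; under eq_cvg do rewrite big_ord_recr/=.
by apply: cvgD; [apply: IH => i /ltnW; exact: H|exact: H].
Qed.

(** All series are cut at one index [m]: the bounds at a doubled radius make both tails small,
    uniformly in large [n], and only finitely many coefficients remain. *)
Lemma unif_of_coef (R : realType) (c : nat -> nat -> R) (f : nat -> R) :
  (forall n i, (n < i)%N -> c n i = 0) -> entire_coefs f ->
  (forall i, c n i @[n --> \oo] --> f i) ->
  (forall rho : R, 0 < rho -> exists C, \forall n \near \oo,
     forall i, `|c n i| * rho ^+ i <= C) ->
  cvg_unif_compacts (fun n z => \sum_(i < n.+1) (c n i)%:C * z ^+ (2 * i))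
    (even_series f).
Proof.
move=> c0 fE cf cE; apply/cvg_unif_compactsP => K cK e e0.
have [s s0 KP] := compact_normc_bounded cK.
have rho0 : 0 < s ^+ 2 by rewrite exprn_gt0.
have [C fC] := fE (2 * s ^+ 2) (mulr_gt0 (ltr0Sn _ 1) rho0).
have [C' cC] := cE (2 * s ^+ 2) (mulr_gt0 (ltr0Sn _ 1) rho0).
have e30 : 0 < e / 4 by rewrite divr_gt0.
have small B : exists m0, forall m, (m0 <= m)%N -> 2 * B / 2 ^+ m <= e / 4.
  have /cvgrPdist_le/(_ _ e30)[m0 _ m0P] := @cvg_half_powers R (2 * B).
  by exists m0 => m /m0P; rewrite sub0r normrN; exact/le_trans/ler_norm.
have [m1 m1P] := small C; have [m2 m2P] := small C'.
pose m := maxn m1 m2.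
have : \sum_(i < m) `|f i - c n i| * (s ^+ 2) ^+ i @[n --> \oo] -->
    \sum_(i < m) (0 : R).
  apply: (@cvg_sum_ord R m (fun i n => `|f i - c n i| * (s ^+ 2) ^+ i)
    (fun=> 0)).
  move=> i _; rewrite -(mul0r ((s ^+ 2) ^+ i)); apply: cvgMl.
  rewrite -(normr0 R) -(subrr (f i)); apply: cvg_norm.
  by apply: cvgB => //; exact: cvg_cst.
rewrite big1// => /cvgrPdist_le/(_ _ e30) sP.
near=> n.
have cn : forall k, `|c n k| * (2 * s ^+ 2) ^+ k <= C' by near: n.
have mn : (m <= n)%N by near: n; exists m.
have sn : `|0 - \sum_(i < m) `|f i - c n i| * (s ^+ 2) ^+ i| <= e / 4.
  by near: n.
move=> z Kz; have zs : normc z ^+ 2 <= s ^+ 2.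
  by rewrite lerXn2r ?nnegrE ?normc_ge0 ?(ltW s0)//; exact: KP.
have -> : even_series f z - \sum_(i < n.+1) (c n i)%:C * z ^+ (2 * i) =
   (even_series f z - \sum_(i < m) (f i)%:C * z ^+ (2 * i)) +
   \sum_(i < m) (f i - c n i)%:C * z ^+ (2 * i) -
   (\sum_(i < n.+1) (c n i)%:C * z ^+ (2 * i)
     - \sum_(i < m) (c n i)%:C * z ^+ (2 * i)).
  under [X in _ + X - _]eq_bigr do rewrite rmorphB mulrBl.
  by rewrite sumrB; ring.
apply: le_lt_trans (le_normcD _ _) _; rewrite normcN.
have h1 : normc (even_series f z - \sum_(i < m) (f i)%:C * z ^+ (2 * i))
  <= e / 4.
  apply: le_trans (m1P m (leq_maxl _ _)); exact: even_series_tail fC.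
have h2 : normc (\sum_(i < n.+1) (c n i)%:C * z ^+ (2 * i)
     - \sum_(i < m) (c n i)%:C * z ^+ (2 * i)) <= e / 4.
  apply: le_trans (m2P m (leq_maxr _ _)).
  apply: (@sum_tail_le _ (fun i => (c n i)%:C * z ^+ (2 * i)) C').
    by move=> k; exact: even_term_le zs (cn k).
  by rewrite ltnW// ltnS.
have h3 : normc (\sum_(i < m) (f i - c n i)%:C * z ^+ (2 * i)) <= e / 4.
  apply: (@le_trans _ _ (\sum_(i < m) `|f i - c n i| * (s ^+ 2) ^+ i)).
    apply: (le_trans (@ler_normc_sum _ _
      (fun i => (f i - c n i)%:C * z ^+ (2 * i)))).
    apply: ler_sum => i _; rewrite normcM normcR normcX exprM ler_wpM2l//.
    by rewrite lerXn2r ?nnegrE ?exprn_ge0 ?normc_ge0// ltW.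
  apply: le_trans (ler_norm _) _; rewrite -normrN -sub0r.
  exact: sn.
have := le_normcD (even_series f z - \sum_(i < m) (f i)%:C * z ^+ (2 * i))
  (\sum_(i < m) (f i - c n i)%:C * z ^+ (2 * i)).
lra.
Unshelve. all: by end_near. Qed.

(** * Power asymptotics *)

Lemma stolz_cesaro (R : realType) (x y : nat -> R) (L : R) :
  (forall n, y n < y n.+1) -> y n @[n --> \oo] --> +oo ->
  (x n.+1 - x n) / (y n.+1 - y n) @[n --> \oo] --> L ->
  x n / y n @[n --> \oo] --> L.
Proof.
move=> y_incr y_oo /cvgrPdist_le H; apply/cvgrPdist_le => e e0.
have e20 : 0 < e / 2 by rewrite divr_gt0.
have [n0 _ n0P] := H _ e20.
(* The estimates on single increments add up because [y] increases. *)
have step n : (n0 <= n)%N ->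
    `|x n - x n0 - L * (y n - y n0)| <= e / 2 * (y n - y n0).
  move=> n0n; rewrite -(subnKC n0n); elim: (n - n0)%N => [|k IH].
    by rewrite addn0 !subrr !mulr0 subrr normr0.
  rewrite addnS; set m := (n0 + k)%N in IH *.
  have dy : 0 < y m.+1 - y m by rewrite subr_gt0.
  have := n0P m (leq_addr _ _); rewrite /= => h.
  have {}h : `|x m.+1 - x m - L * (y m.+1 - y m)| <= e / 2 * (y m.+1 - y m).
    rewrite -[X in X - L * _](divfK (lt0r_neq0 dy)) -mulrBl normrM distrC.
    by rewrite (gtr0_norm dy) ler_wpM2r// ltW.
  have -> : x m.+1 - x n0 - L * (y m.+1 - y n0) =
    (x m - x n0 - L * (y m - y n0)) + (x m.+1 - x m - L * (y m.+1 - y m)).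
    by ring.
  apply: le_trans (ler_normD _ _) _; lra.
(* The cost of starting at [n0]. It is at most e/2 * y n once y n >= 2 K / e; the 1 added to this
   threshold ensures y n > 0. *)
pose K := `|x n0 - L * y n0| + e / 2 * `|y n0|.
near=> n.
have n0n : (n0 <= n)%N by near: n; exists n0.
have yn : 1 + 2 * K / e <= y n by near: n; exact: (cvgryPge y).1.
have K0 : 0 <= K by rewrite /K addr_ge0// mulr_ge0// ltW.
have yn0 : 0 < y n.
  by apply: lt_le_trans yn; rewrite ltr_pwDl// divr_ge0 ?(ltW e0)// mulr_ge0.
have Ky : K <= e / 2 * y n.
  have : 2 * K / e <= y n by apply: le_trans yn; rewrite lerDr.
  by rewrite ler_pdivrMr//; lra.
have -> : L - x n / y n = - ((x n - L * y n) / y n).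
  by field; rewrite gt_eqF.
rewrite normrN normrM normfV (gtr0_norm yn0) ler_pdivrMr//.
have -> : x n - L * y n =
  (x n - x n0 - L * (y n - y n0)) + (x n0 - L * y n0) by ring.
apply: le_trans (ler_normD _ _) _.
have := step n n0n; have := ler_norm (- y n0); rewrite normrN.
move: Ky; rewrite /K; set u := `|x n0 - L * y n0|; set v := `|y n0|.
by move=> h1 h2 h3; have := ler_wpM2l (ltW e20) h2; lra.
Unshelve. all: by end_near. Qed.

Lemma powR_nat_incr (R : realType) (k : R) (n : nat) : 0 < k ->
  n%:R `^ k < n.+1%:R `^ k :> R.
Proof. by move=> k0; rewrite gt0_ltr_powR ?nnegrE// ltr_nat. Qed.

Lemma powR_nat_cvgy (R : realType) (k : R) : 0 < k ->
  (n%:R `^ k : R) @[n --> \oo] --> +oo.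
Proof.
move=> k0; apply/cvgryPge => M; near=> n.
have M0 : 0 <= `|M| `^ k^-1 by exact: powR_ge0.
have h : `|M| `^ k^-1 <= n%:R by near: n; exact: nbhs_infty_ger.
apply: le_trans (ler_norm M) _.
have := ge0_ler_powR (ltW k0) (x := `|M| `^ k^-1) (y := n%:R).
by rewrite -powRrM mulVf ?gt_eqF// powRr1//; apply; rewrite ?nnegrE.
Unshelve. all: by end_near. Qed.

(** With h = 1/n the expression is the difference quotient ((1 + h)^k - 1) / h of t^k at t = 1. *)
Lemma powR_nat_diff (R : realType) (k : R) :
  (n.+1%:R `^ k - n%:R `^ k) / n%:R `^ (k - 1) @[n --> \oo] --> (k : R).
Proof.
have [d e] := @is_derive1_powR R k 1 ltr01.
have {d} := d; rewrite /derivable => /cvg_ex[l lP].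
have lk : l = k.
  by rewrite -(cvg_lim _ lP)// -[LHS]/(derive _ _ _) e powR1 mulr1.
rewrite {}lk in lP.
have {}lP : n.+1%:R * ((1 + n.+1%:R^-1) `^ k - 1) @[n --> \oo] --> k.
  have h0 : (forall n, n.+1%:R^-1 != 0 :> R) /\ (n.+1%:R^-1 : R) @[n --> \oo] -->
      0.
    by split; [move=> n; rewrite gt_eqF ?invr_gt0|exact: cvg_harmonic].
  have := (cvgr_dnbhsP _ _ _).1 lP _ h0; apply: cvg_trans; apply: near_eq_cvg.
  by near=> n; rewrite invrK /GRing.scale/= mulr1 powR1 [1 + _]addrC.
rewrite -cvg_shiftS/=; move: lP; apply: cvg_trans; apply: near_eq_cvg.
near=> n; have n0 : (0 : R) < n.+1%:R by rewrite ltr0n.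
have -> : n.+2%:R = n.+1%:R * (1 + n.+1%:R^-1) :> R.
  by rewrite mulrDr mulr1 divff ?gt_eqF// natr1.
rewrite powRM ?(ltW n0) ?addr_ge0 ?invr_ge0// powRB;
  last by rewrite (gt_eqF n0) implybT.
rewrite powRr1 ?(ltW n0)//; field.
by rewrite gt_eqF//= gt_eqF ?powR_gt0.
Unshelve. all: by end_near. Qed.

(** When 1/s_n and b_n grow like n^a and n^b, this has order n^-(1 + 2a + b e), the inverse of the
    growth of sum_(k < n) b_k^e / s_k^2. The factor 1/n accounts for the summation over k. *)
Definition kernel_weight (R : realType) (s b : nat -> R) (e n : nat) : R :=
  s n ^+ 2 / (n%:R * b n ^+ e).

(* For [x k = c k i * c k m] and [e = i + m], with [c] the scaled Taylor
   coefficients of the [p_k], this is a multiple of the scaled derivative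
   of order [(i, m)] of the kernel [sum_(k < n) p_k(x) p_k(y)] at [(c, c)]. *)
Definition kernel_sum (R : realType) (s b : nat -> R) (e : nat) (x : nat -> R)
    (n : nat) : R :=
  kernel_weight s b e n * \sum_(k < n) (b k ^+ e / s k ^+ 2 * x k).

Lemma cvg_exprn (R : realType) (u : nat -> R) (l : R) (e : nat) :
  u n @[n --> \oo] --> l -> u n ^+ e @[n --> \oo] --> l ^+ e.
Proof.
move=> ul; elim: e => [|e IH]; first exact: cvg_cst.
by rewrite exprS; under eq_cvg do rewrite exprS; exact: cvgM.
Qed.

Lemma powR_natM (R : realType) (x t : R) (e : nat) : x `^ (t * e%:R) =
  (x `^ t) ^+ e.
Proof. by rewrite powRrM powR_mulrn ?powR_ge0. Qed.

(** One form of the exponent shows positivity and the Cauchy structure, the other the growth order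
    of the kernel sums. *)
Lemma asym_exponent_gt0 (R : realType) (a b nu : R) (e : nat) : 0 < b ->
  -1 < nu ->
  2 * a + 1 = b * (nu + 1) ->
  0 < b * (nu + 1 + e%:R) /\ b * (nu + 1 + e%:R) = 1 + a * 2%:R + b * e%:R.
Proof.
move=> b0 nu1 H; split; last by lra.
by rewrite mulr_gt0// ltr_pwDl//; lra.
Qed.

Lemma cvg_weight (R : realType) (s bt : nat -> R) (A a B b : R) (e : nat) :
  asym_equiv (fun n => (s n)^-1) (fun n => A * n%:R `^ a) ->
  asym_equiv bt (fun n => B * n%:R `^ b) ->
  A ^+ 2 * B ^+ e * (((s n)^-1 / (A * n%:R `^ a)) ^+ 2
    * (bt n / (B * n%:R `^ b)) ^+ e) @[n --> \oo] --> A ^+ 2 * B ^+ e.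
Proof.
move=> sA bA; rewrite -[X in _ --> X]mulr1; apply: cvgM; first exact: cvg_cst.
have e1 : 1 = 1 ^+ 2 * 1 ^+ e :> R by rewrite !expr1n mulr1.
rewrite [X in _ --> X]e1.
by apply: cvgM; apply: cvg_exprn.
Qed.

Lemma kernel_weight_cvg (R : realType) (s bt : nat -> R) (A a B b nu : R)
  (e : nat) :
  0 < A -> 0 < B -> 0 < b -> -1 < nu -> 2 * a + 1 = b * (nu + 1) ->
  asym_equiv (fun n => (s n)^-1) (fun n => A * n%:R `^ a) ->
  asym_equiv bt (fun n => B * n%:R `^ b) ->
  kernel_weight s bt e n * n%:R `^ (b * (nu + 1 + e%:R)) @[n --> \oo] -->
    (A ^+ 2 * B ^+ e)^-1.
Proof.
move=> A0 B0 b0 nu1 H sA bA.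
have [k0 kE] := asym_exponent_gt0 e b0 nu1 H.
have h := cvg_weight (e := e) sA bA.
have w0 : A ^+ 2 * B ^+ e != 0 by rewrite gt_eqF// mulr_gt0 ?exprn_gt0.
apply: cvg_trans (cvgV w0 h).
apply: near_eq_cvg; near=> n; have n0 : (0 : R) < n%:R.
  by rewrite ltr0n; near: n; exists 1%N.
rewrite /= kE !powRD ?(gt_eqF n0) ?implybT// powRr1 ?(ltW n0)// !powR_natM
  /kernel_weight.
set x := n%:R `^ a; set y := n%:R `^ b.
have x0 : x != 0 by rewrite gt_eqF ?powR_gt0.
have y0 : y != 0 by rewrite gt_eqF ?powR_gt0.
rewrite !exprMn !exprVn !exprMn !invfM !invrK.
move: (bt n ^- e) => t; field.
by rewrite !gt_eqF ?exprn_gt0.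
Unshelve. all: by end_near. Qed.

Lemma kernel_weight_cvg0 (R : realType) (s bt : nat -> R) (A a B b nu : R)
  (e : nat) :
  0 < A -> 0 < B -> 0 < b -> -1 < nu -> 2 * a + 1 = b * (nu + 1) ->
  asym_equiv (fun n => (s n)^-1) (fun n => A * n%:R `^ a) ->
  asym_equiv bt (fun n => B * n%:R `^ b) ->
  kernel_weight s bt e n @[n --> \oo] --> (0 : R).
Proof.
move=> A0 B0 b0 nu1 H sA bA.
have [k0 _] := asym_exponent_gt0 e b0 nu1 H.
have h := kernel_weight_cvg (e := e) A0 B0 b0 nu1 H sA bA.
have h' : (n%:R `^ (b * (nu + 1 + e%:R)))^-1 @[n --> \oo] --> (0 : R).
  by apply/gtr0_cvgV0; [near=> n; rewrite powR_gt0 ?ltr0n//; near: n; exists 1%N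
    |exact: powR_nat_cvgy].
rewrite -(mulr0 (A ^+ 2 * B ^+ e)^-1).
apply: cvg_trans (cvgM h h'); apply: near_eq_cvg; near=> n.
rewrite /= mulfK// gt_eqF// powR_gt0// ltr0n; near: n; exists 1%N => //.
Unshelve. all: by end_near. Qed.

(** Stolz-Cesaro against n^k with k = 1 + 2a + b e: the sum has increments of order n^(k-1), and
    those of n^k are asymptotic to k n^(k-1), which produces the denominator. *)
Lemma kernel_sum_cvg (R : realType) (s bt : nat -> R) (A a B b nu : R) (e : nat)
    (x : nat -> R) (L : R) :
  0 < A -> 0 < B -> 0 < b -> -1 < nu -> 2 * a + 1 = b * (nu + 1) ->
  asym_equiv (fun n => (s n)^-1) (fun n => A * n%:R `^ a) ->
  asym_equiv bt (fun n => B * n%:R `^ b) ->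
  x n @[n --> \oo] --> L ->
  kernel_sum s bt e x n @[n --> \oo] --> L / (b * (nu + 1 + e%:R)).
Proof.
move=> A0 B0 b0 nu1 H sA bA xL.
have [k0 kE] := asym_exponent_gt0 e b0 nu1 H.
set k := b * (nu + 1 + e%:R) in k0 kE *.
pose S n := \sum_(j < n) (bt j ^+ e / s j ^+ 2 * x j).
have SL : S n / n%:R `^ k @[n --> \oo] --> A ^+ 2 * B ^+ e * L / k.
  apply: stolz_cesaro.
  - by move=> n; exact: powR_nat_incr.
  - exact: powR_nat_cvgy.
  apply: cvg_trans (cvgM (cvgM (cvg_weight (e := e) sA bA) xL)
    (cvgV (lt0r_neq0 k0) (@powR_nat_diff R k))).
  apply: near_eq_cvg; near=> n.
  have n0 : (0 : R) < n%:R by rewrite ltr0n; near: n; exists 1%N.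
  rewrite /S big_ord_recr/= [_ + _ - _]addrC addKr.
  have -> : k - 1 = a * 2%:R + b * e%:R by rewrite kE; lra.
  rewrite !powRD ?(gt_eqF n0) ?implybT// !powR_natM.
  have : n.+1%:R `^ k - n%:R `^ k != 0.
    by rewrite gt_eqF// subr_gt0 powR_nat_incr.
  move: (n.+1%:R `^ k - n%:R `^ k) => d d0.
  have : n%:R `^ a != 0 by rewrite gt_eqF ?powR_gt0.
  have : n%:R `^ b != 0 by rewrite gt_eqF ?powR_gt0.
  move: (n%:R `^ a) (n%:R `^ b) => u v v0 u0.
  rewrite !exprMn !exprVn !exprMn !invfM !invrK.
  move: (s n)^-1 => t; field.
  by rewrite d0 u0 (expf_neq0 _ v0) !gt_eqF ?exprn_gt0.
have -> : L / k = (A ^+ 2 * B ^+ e)^-1 * (A ^+ 2 * B ^+ e * L / k).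
  by field; rewrite !gt_eqF ?exprn_gt0.
apply: cvg_trans (cvgM (kernel_weight_cvg (e := e) A0 B0 b0 nu1 H sA bA) SL).
apply: near_eq_cvg; near=> n.
have n0 : (0 : R) < n%:R by rewrite ltr0n; near: n; exists 1%N.
rewrite /= /kernel_sum -/(S n) -/k; field.
by rewrite gt_eqF ?powR_gt0.
Unshelve. all: by end_near. Qed.

(** Past some index [bt] stays within a factor 2 of B n^b on either side, whence the 4; the finitely
    many earlier terms are eventually below [bt n] because n^b is unbounded. *)
Lemma regular_seq_almost_incr (R : realType) (bt : nat -> R) (B b : R) :
  (forall n, 0 < bt n) -> 0 < B -> 0 < b ->
  asym_equiv bt (fun n => B * n%:R `^ b) ->
  \forall n \near \oo, forall k, (k < n)%N -> bt k <= 4 * bt n.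
Proof.
move=> bt0 B0 b0 /cvgrPdist_le /(_ (2^-1)).
rewrite invr_gt0 => /(_ (ltr0Sn _ _)) [n0 _ n0P].
have bnd n : (n0 < n)%N -> B * n%:R `^ b / 2 <= bt n <= 2 * (B * n%:R `^ b).
  move=> n0n; have y0 : 0 < B * n%:R `^ b.
    by rewrite mulr_gt0// powR_gt0// ltr0n (leq_trans _ n0n).
  have := n0P n (ltnW n0n); rewrite /= ler_distlC => /andP[h1 h2].
  rewrite ler_pdivlMr// in h1; rewrite ler_pdivrMr// in h2.
  by apply/andP; split; lra.
pose S := \sum_(k < n0.+1) bt k.
near=> n => k kn.
have n0n : (n0 < n)%N by near: n; exists n0.+1.
have /andP[h1 _] := bnd n n0n.
have [k0|k0] := leqP k n0.
  have h : bt k <= S.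
    rewrite /S (bigD1 (Ordinal (k0 : (k < n0.+1)%N)))//= lerDl.
    by apply: sumr_ge0 => i _; exact: ltW.
  have SB : 2 * S / B <= n%:R `^ b.
    by near: n; exact: (cvgryPge (fun n => n%:R `^ b)).1 (powR_nat_cvgy b0) _.
  rewrite ler_pdivrMr// in SB.
  by have := bt0 n; lra.
have /andP[_ h2] := bnd k k0.
have : k%:R `^ b <= n%:R `^ b :> R.
  by apply: ge0_ler_powR; rewrite ?nnegrE// ?(ltW b0)// ler_nat ltnW.
move=> /(ler_wpM2l (ltW B0)); lra.
Unshelve. all: by end_near. Qed.

(** The factor (bt k / bt n)^m is at most 4^m, which the bounds on [v] at radius [4 * rho] absorb.
    The kernel sum left on the right is independent of [m]. *)
Lemma kernel_sum_bound (R : realType) (s bt : nat -> R) (u : nat -> R)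
    (v : nat -> nat -> R) (rho C : R) (i m n : nat) :
  (forall n, 0 < s n) -> (forall n, 0 < bt n) -> 0 < rho ->
  (forall k, (k < n)%N -> bt k <= 4 * bt n) ->
  (forall k m, `|v k m| * (4 * rho) ^+ m <= C) ->
  `|kernel_sum s bt (i + m) (fun k => u k * v k m) n| * rho ^+ m <=
    C * kernel_sum s bt i (fun k => `|u k|) n.
Proof.
move=> s0 bt0 rho0 H vC; case: n H => [|n] H.
  by rewrite /kernel_sum !big_ord0 !mulr0 normr0 mul0r.
rewrite /kernel_sum [C * _]mulrCA normrM -mulrA.
have W e : 0 < kernel_weight s bt e n.+1.
  by rewrite /kernel_weight divr_gt0 ?exprn_gt0// mulr_gt0 ?exprn_gt0.
rewrite (gtr0_norm (W _)).
have -> : kernel_weight s bt (i + m) n.+1 =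
  kernel_weight s bt i n.+1 / bt n.+1 ^+ m.
  by rewrite /kernel_weight exprD !invfM !mulrA.
rewrite -mulrA ler_wpM2l ?(ltW (W _))// mulr_sumr mulrCA.
apply: (@le_trans _ _ ((\sum_(k < n.+1) `|bt k ^+ (i + m) / s k ^+ 2
  * (u k * v k m)|) *
   ((bt n.+1 ^+ m)^-1 * rho ^+ m))).
  rewrite ler_wpM2r ?ler_norm_sum//.
  by rewrite mulr_ge0 ?invr_ge0 ?exprn_ge0// ltW.
rewrite mulr_suml; apply: ler_sum => k _.
have bk := bt0 k; have bn := bt0 n.+1.
rewrite !normrM normfV !normrX (gtr0_norm (s0 _)) (gtr0_norm bk) exprD.
set X := bt k ^+ i / s k ^+ 2 * `|u k|.
have X0 : 0 <= X by rewrite mulr_ge0// divr_ge0// exprn_ge0// ltW.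
have -> : bt k ^+ i * bt k ^+ m / s k ^+ 2 * (`|u k| * `|v k m|) *
    ((bt n.+1 ^+ m)^-1 * rho ^+ m) =
      X * (`|v k m| * ((bt k / bt n.+1) ^+ m * rho ^+ m)).
  by rewrite /X exprMn exprVn; ring.
rewrite [C * _]mulrC ler_wpM2l//; apply: le_trans (vC k m).
rewrite ler_wpM2l// [(4 * _) ^+ m]exprMn ler_wpM2r ?exprn_ge0 ?(ltW rho0)//.
apply: lerXn2r; rewrite ?nnegrE//; first by rewrite divr_ge0// ltW.
by rewrite ler_pdivrMr// H.
Qed.

(** * Orthogonal polynomials *)

Lemma horner_integrable (R : realType)
    (mu : {measure set (measurableTypeR R) -> \bar R}) (f : {poly R}) :
  (forall n : nat, mu.-integrable setT (fun x => (x ^+ n)%:E)) ->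
  mu.-integrable setT (fun x => (f.[x])%:E).
Proof.
move=> H; have -> : (fun x => (f.[x])%:E) =
    (fun x => \sum_(i < size f) ((f`_i)%:E * (x ^+ i)%:E)%E)%E.
  by apply/funext => x; rewrite horner_coef -sumEFin.
by apply: integrable_sum => // i _; exact: integrableZl.
Qed.

Definition bilinear_form (R : realType) (ip : {poly R} -> {poly R} -> R) :
  Prop :=
  [/\ forall f g, ip f g = ip g f,
      forall f g h, ip (f + g) h = ip f h + ip g h &
      forall a f h, ip (a *: f) h = a * ip f h].

Lemma weighted_ip_bilinear (R : realType)
    (mu : {measure set (measurableTypeR R) -> \bar R}) (c : R) (j : nat) :
  (forall n : nat, mu.-integrable setT (fun x => (x ^+ n)%:E)) ->
  bilinear_form (weighted_ip mu c j).
Proof.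
move=> H; have int (f g : {poly R}) :
    mu.-integrable setT (EFin \o (fun x => f.[x] * g.[x] * (x - c) ^+ (2 * j))).
  have := horner_integrable (f * g * ('X - c%:P) ^+ (2 * j)) H.
  by congr (integrable _ _); apply/funext => x /=; rewrite !hornerE.
rewrite /weighted_ip; split=> [f g|f g h|a f h].
- by apply: eq_Rintegral => x _; rewrite [f.[x] * _]mulrC.
- rewrite -RintegralD//; apply: eq_Rintegral => x _.
  by rewrite hornerD !mulrDl.
- rewrite -RintegralZl//; apply: eq_Rintegral => x _.
  by rewrite hornerZ !mulrA.
Qed.

Lemma weighted_ip0E (R : realType)
    (mu : {measure set (measurableTypeR R) -> \bar R}) (c : R)
    (f g : {poly R}) :
  weighted_ip mu c 0 f g = \int[mu]_x (f.[x] * g.[x]).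
Proof. by apply: eq_Rintegral => x _; rewrite muln0 expr0 mulr1. Qed.

Lemma sobolev_ipE (R : realType)
    (mu : {measure set (measurableTypeR R) -> \bar R}) (c : R) (r : nat)
    (M : 'I_r.+1 -> R) (f g : {poly R}) :
  sobolev_ip mu c M f g = weighted_ip mu c 0 f g +
    \sum_(i < r.+1) M i * f^`(i).[c] * g^`(i).[c].
Proof. by rewrite weighted_ip0E. Qed.

Lemma sobolev_ip_bilinear (R : realType)
    (mu : {measure set (measurableTypeR R) -> \bar R}) (c : R) (r : nat)
    (M : 'I_r.+1 -> R) :
  (forall n : nat, mu.-integrable setT (fun x => (x ^+ n)%:E)) ->
  bilinear_form (sobolev_ip mu c M).
Proof.
move=> /(weighted_ip_bilinear c 0)[C D Z]; split=> [f g|f g h|a f h].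
- rewrite !sobolev_ipE C; congr (_ + _); apply: eq_bigr => i _.
  by rewrite mulrAC.
- rewrite !sobolev_ipE D addrACA -big_split; congr (_ + _).
  by apply: eq_bigr => i _; rewrite derivnD hornerD mulrDr mulrDl.
- rewrite !sobolev_ipE Z mulrDr mulr_sumr; congr (_ + _).
  by apply: eq_bigr => i _; rewrite derivnZ hornerZ; ring.
Qed.

Lemma bilinear_suml (R : realType) (ip : {poly R} -> {poly R} -> R) (n : nat)
    (a : nat -> R) (p : nat -> {poly R}) (h : {poly R}) :
  bilinear_form ip ->
  ip (\sum_(k < n) a k *: p k) h = \sum_(k < n) a k * ip (p k) h.
Proof.
case=> _ D Z; elim: n => [|n IH]; last by rewrite !big_ord_recr/= D Z IH.
by rewrite !big_ord0 -(scale0r 0) Z mul0r.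
Qed.

Lemma polys_span (R : fieldType) (p : nat -> {poly R}) (n : nat)
    (f : {poly R}) :
  (forall n, size (p n) = n.+1) -> (size f <= n)%N ->
  exists a : nat -> R, f = \sum_(k < n) a k *: p k.
Proof.
move=> sp; elim: n f => [|n IH] f sf.
  by exists (fun=> 0); rewrite big_ord0; apply/eqP; rewrite -size_poly_leq0.
have pn0 : (p n)`_n != 0.
  by rewrite -[n in _`_n]/(n.+1.-1) -(sp n) -lead_coefE lead_coef_eq0
    -size_poly_eq0 sp.
have [|a fa] := IH (f - (f`_n / (p n)`_n) *: p n).
  apply/leq_sizeP => j; rewrite leq_eqVlt coefB coefZ => /orP[/eqP <-|nj].
    by rewrite divfK// subrr.
  by rewrite [f`_j]nth_default ?(leq_trans sf nj)// [(p n)`_j]nth_default ?sp//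
    mulr0 subrr.
exists (fun k => if k == n then f`_n / (p n)`_n else a k).
rewrite big_ord_recr/= eqxx; apply/eqP; rewrite -subr_eq {}fa; apply/eqP.
by apply: eq_bigr => k _; rewrite ltn_eqF.
Qed.

Lemma orthonormal_expand (R : realType) (ip : {poly R} -> {poly R} -> R)
    (p : nat -> {poly R}) (n : nat) (f : {poly R}) :
  bilinear_form ip -> orthonormal_polys ip p -> (size f <= n)%N ->
  f = \sum_(k < n) ip f (p k) *: p k.
Proof.
move=> B [sp _ op] /(polys_span sp)[a fa].
rewrite {1}fa; apply: eq_bigr => j _; congr (_ *: _).
rewrite fa bilinear_suml// (bigD1 j)//= big1 => [|i ij].
  by rewrite addr0 op eqxx mulr1.
by rewrite op (_ : (i == j :> nat) = false) ?mulr0//; exact/negbTE.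
Qed.

Lemma orthonormal_lower (R : realType) (ip : {poly R} -> {poly R} -> R)
    (q : nat -> {poly R}) (n : nat) (f : {poly R}) :
  bilinear_form ip -> orthonormal_polys ip q -> (size f <= n)%N ->
  ip f (q n) = 0.
Proof.
move=> B oq sf; rewrite (orthonormal_expand B oq sf).
rewrite (bilinear_suml _ (fun k => ip f (q k)) q _ B).
by apply: big1 => i _; case: oq => _ _ ->; rewrite ltn_eqF ?mulr0.
Qed.

(** For k < n, [q n] is Sobolev-orthogonal to [p k], so its coefficient for [mu] is minus the mass
    part. The coefficient [g] is a ratio of positive leading coefficients. The last identity is the
    normalization of [q n]: only the term [g *: p n] contributes to its product with [q n]. *)
Lemma sobolev_connection (R : realType)
    (mu : {measure set (measurableTypeR R) -> \bar R}) (c : R) (r : nat)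
    (M : 'I_r.+1 -> R) (p q : nat -> {poly R}) :
  (forall n : nat, mu.-integrable setT (fun x => (x ^+ n)%:E)) ->
  orthonormal_polys (weighted_ip mu c 0) p ->
  orthonormal_polys (sobolev_ip mu c M) q ->
  forall n, exists g : R, [/\ 0 < g,
    q n = g *: p n - \sum_(k < n)
      (\sum_(i < r.+1) M i * (q n)^`(i).[c] * (p k)^`(i).[c]) *: p k &
    g * (g + \sum_(i < r.+1) M i * (q n)^`(i).[c] * (p n)^`(i).[c]) = 1].
Proof.
move=> H op oq n; have B1 := weighted_ip_bilinear c 0 H.
have B2 := sobolev_ip_bilinear c M H.
have [C2 _ _] := B2.
have [sp lp _] := op; have [sq lq oq'] := oq.
pose g := weighted_ip mu c 0 (q n) (p n).
have low k : (k < n)%N -> weighted_ip mu c 0 (q n) (p k) =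
    - \sum_(i < r.+1) M i * (q n)^`(i).[c] * (p k)^`(i).[c].
  move=> kn; apply/eqP; rewrite -addr_eq0 -sobolev_ipE C2.
  by rewrite (orthonormal_lower B2 oq)// sp.
have E : q n = g *: p n - \sum_(k < n)
    (\sum_(i < r.+1) M i * (q n)^`(i).[c] * (p k)^`(i).[c]) *: p k.
  rewrite {1}(orthonormal_expand B1 op (eq_leq (sq n))) big_ord_recr/= addrC.
  congr (_ + _); rewrite -sumrN; apply: eq_bigr => k _.
  by rewrite low// scaleNr.
exists g; split=> //.
- have := congr1 (fun f : {poly R} => f`_n) E.
  rewrite coefB coefZ coef_sum big1 ?subr0 => [|k _]; last first.
    by rewrite coefZ nth_default ?mulr0// sp.
  have := lp n; have := lq n; rewrite !lead_coefE sp sq/= => q0 p0 e.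
  by rewrite -(pmulr_lgt0 _ p0) -e.
- have := oq' n n; rewrite eqxx {1}(orthonormal_expand B1 op (eq_leq (sq n))).
  rewrite (bilinear_suml _ (fun k => weighted_ip mu c 0 (q n) (p k)) p _ B2).
  rewrite big_ord_recr/= big1 ?add0r => [|k _]; last first.
    by rewrite (orthonormal_lower B2 oq) ?mulr0// sp.
  by rewrite -/g C2 sobolev_ipE.
Qed.

(** * Cauchy systems *)

Lemma poly_nat_roots_eq0 (R : realFieldType) (n : nat) (P : {poly R}) :
  (size P <= n)%N -> (forall i, (i < n)%N -> P.[i%:R] = 0) -> P = 0.
Proof.
move=> Pn P0; apply/eqP/negPn/negP => nP.
have : (size [seq i%:R : R | i <- iota 0 n] < size P)%N.
  apply: max_poly_roots => //.
    apply/allP => x /mapP[j]; rewrite mem_iota => /andP[_ j_n] ->.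
    by apply/eqP; exact: P0.
  by rewrite map_inj_uniq ?iota_uniq//; exact: (@mulrIn R 1 (oner_neq0 _)).
by rewrite size_map size_iota ltnNge Pn.
Qed.

(** The numerator of sum_j w_j / (x + k + j) over the common denominator. *)
Definition cauchy_num (R : realFieldType) (n : nat) (k : R) (w : 'I_n -> R) :
    {poly R} :=
  \sum_j w j *: \prod_(l < n | l != j) ('X - (- (k + l%:R))%:P).

Lemma size_cauchy_num (R : realFieldType) (n : nat) (k : R) (w : 'I_n -> R) :
  (size (cauchy_num k w) <= n)%N.
Proof.
apply: (leq_trans (size_sum _ _ _)); apply/bigmax_leqP => j _.
apply: leq_trans (size_scale_leq _ _) _.
rewrite size_prod => [|l _]; last by rewrite polyXsubC_eq0.
under eq_bigr do rewrite size_XsubC.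
rewrite sum_nat_const muln2 -addnn -addSn addnK.
by rewrite cardC1 card_ord; case: n w j => [w []|].
Qed.

Lemma horner_cauchy_num (R : realFieldType) (n : nat) (k : R) (w : 'I_n -> R)
    (x : R) : (forall l : 'I_n, x + k + l%:R != 0) ->
  (cauchy_num k w).[x] =
  \prod_(l < n) (x + k + l%:R) * \sum_j w j / (x + k + j%:R).
Proof.
move=> x0; rewrite horner_sum mulr_sumr; apply: eq_bigr => j _.
rewrite hornerZ horner_prod [in RHS](bigD1 j)//=.
under eq_bigr do rewrite hornerXsubC opprK addrA.
by field; exact: x0.
Qed.

(** The numerator has degree below [n] and the [n] roots 0, ..., n - 1, hence is zero; its value at
    the pole -(k + j) isolates [w j]. *)
Lemma cauchy_system_inj (R : realFieldType) (n : nat) (k : R) (w : 'I_n -> R) :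
  0 < k ->
  (forall i : 'I_n, \sum_j w j / (k + i%:R + j%:R) = 0) -> forall j, w j = 0.
Proof.
move=> k0 H j.
have P0 : cauchy_num k w = 0.
  apply: poly_nat_roots_eq0 (size_cauchy_num k w) _ => i i_n.
  rewrite horner_cauchy_num => [|l];
    last by rewrite gt_eqF// -addrA ltr_wpDl// ltr_pwDl.
  have := H (Ordinal i_n); under eq_bigr do rewrite [k + _]addrC.
  by move=> ->; rewrite mulr0.
have := congr1 (fun P : {poly R} => P.[- (k + j%:R)]) P0.
rewrite /cauchy_num horner0 horner_sum (bigD1 j)//= [X in _ + X]big1 => [|i ij].
  rewrite addr0 hornerZ => /eqP; rewrite mulf_eq0 => /orP[/eqP//|].
  rewrite horner_prod prodf_seq_eq0 => /hasP[l _ /andP[lj]].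
  rewrite hornerXsubC opprK addrC opprD addrACA subrr add0r subr_eq0.
  by rewrite eqr_nat => /eqP e; move/eqP : lj; case; apply/val_inj.
rewrite hornerZ horner_prod (bigD1 j) 1?eq_sym//= hornerXsubC subrr.
by rewrite mul0r mulr0.
Qed.

(** Over the denominator [P], the function 1 - sum_j w_j / (x + k + j) has a monic numerator of
    degree [n] that vanishes at 0, ..., n - 1, so this numerator is [Q]. *)
Lemma cauchy_system_sol (R : realFieldType) (n : nat) (k : R) (w : 'I_n -> R) :
  0 < k ->
  (forall i : 'I_n, \sum_j w j / (k + i%:R + j%:R) = 1) ->
  forall m : nat, 1 - \sum_j w j / (k + m%:R + j%:R) =
    \prod_(i < n) ((m%:R - i%:R) / (m%:R + k + i%:R)).
Proof.
move=> k0 H m.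
pose P : {poly R} := \prod_(l < n) ('X - (- (k + l%:R))%:P).
pose Q : {poly R} := \prod_(l < n) ('X - (l%:R)%:P).
have pos (i l : nat) : i%:R + k + l%:R != 0.
  by rewrite gt_eqF// -addrA ltr_wpDl// ltr_pwDl.
have sz (F : 'I_n -> R) : size (\prod_(l < n) ('X - (F l)%:P)) = n.+1.
  rewrite size_prod_XsubC; congr _.+1.
  by rewrite /index_enum -enumT size_enum_ord.
have PE x : P.[x] = \prod_(l < n) (x + k + l%:R).
  by rewrite horner_prod; apply: eq_bigr => l _;
    rewrite hornerXsubC opprK addrA.
have QE x : Q.[x] = \prod_(l < n) (x - l%:R).
  by rewrite horner_prod; apply: eq_bigr => l _; rewrite hornerXsubC.
have PQ : P - Q - cauchy_num k w = 0.
  apply: (@poly_nat_roots_eq0 _ n) => [|i i_n].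
    apply: leq_trans (size_polyD _ _) _; rewrite size_polyN geq_max.
    rewrite size_cauchy_num andbT; apply/leq_sizeP => j.
    rewrite leq_eqVlt coefB => /orP[/eqP <-|nj].
      have := lead_coef_prod_XsubC (index_enum 'I_n) xpredT
        (fun l => - (k + l%:R)).
      have := lead_coef_prod_XsubC (index_enum 'I_n) xpredT (fun l => l%:R : R).
      by rewrite !lead_coefE !sz/= /P /Q => -> ->; rewrite subrr.
    by rewrite !nth_default ?subrr// sz.
  rewrite !hornerE horner_cauchy_num => [|l]; last exact: pos.
  have -> : \sum_j w j / (i%:R + k + j%:R) = 1.
    by under eq_bigr do rewrite [_ + k]addrC; exact: (H (Ordinal i_n)).
  rewrite mulr1.
  rewrite PE QE [X in _ - X - _](bigD1 (Ordinal i_n))//= subrr mul0r subr0.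
  by rewrite subrr.
have := congr1 (fun P : {poly R} => P.[m%:R]) PQ.
rewrite !hornerE horner_cauchy_num => [|l]; last exact: pos.
rewrite PE QE big_split/= prodfV.
under [in X in 1 - X]eq_bigr do rewrite [k + _]addrC.
set a := \prod_(l < n) (_ + _ + _); set b := \prod_(l < n) (_ - _).
have a0 : a != 0 by apply/prodf_neq0 => l _; exact: pos.
set c := \sum_j _ => h; apply: (mulIf a0); rewrite divfK// mulrBl mul1r.
by apply/eqP; rewrite -subr_eq0 [c * a]mulrC -h; apply/eqP; ring.
Qed.

Lemma cvg_det (R : realType) (n : nat) (A : nat -> 'M[R]_n) (L : 'M[R]_n) :
  (forall i j, A k i j @[k --> \oo] --> L i j) ->
  \det (A k) @[k --> \oo] --> \det L.
Proof.
move=> H; apply: (@cvg_big R _ +%R 0) => [|s _]; first exact: add_continuous.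
apply: cvgM; first exact: cvg_cst.
apply: (@cvg_big R _ *%R 1) => [|i _]; first exact: mul_continuous.
exact: H.
Qed.

(** Cramer's rule: determinant and adjugate are continuous in the entries, and [\det (A k)] is
    eventually nonzero. *)
Lemma cvg_linear_system (R : realType) (n : nat) (A : nat -> 'M[R]_n)
    (L : 'M[R]_n) (x y : nat -> 'cV[R]_n) (l : 'cV[R]_n) :
  (forall i j, A k i j @[k --> \oo] --> L i j) -> L \in unitmx ->
  (forall i, y k i 0 @[k --> \oo] --> l i 0) ->
  (\forall k \near \oo, A k *m x k = y k) ->
  forall i, x k i 0 @[k --> \oo] --> (invmx L *m l) i 0.
Proof.
move=> AL uL yl sys i.
have dL : \det L != 0 by move: uL; rewrite unitmxE unitfE.
have dA := cvg_det AL.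
have adjA j k : (\adj (A m)) j k @[m --> \oo] --> (\adj L) j k.
  under eq_cvg do rewrite mxE; rewrite mxE /cofactor.
  apply: cvgM; first exact: cvg_cst.
  apply: cvg_det => a b; rewrite !mxE; under eq_cvg do rewrite !mxE.
  exact: AL.
have -> : (invmx L *m l) i 0 = (\det L)^-1 * (\adj L *m l) i 0.
  by rewrite /invmx uL -scalemxAl mxE.
have h : (\adj (A m) *m y m) i 0 @[m --> \oo] --> (\adj L *m l) i 0.
  rewrite mxE; under eq_cvg do rewrite mxE.
  apply: (@cvg_big R _ +%R 0) => [|j _]; first exact: add_continuous.
  exact: cvgM.
apply: cvg_trans (cvgM (cvgV dL dA) h); apply: near_eq_cvg.
near=> k; have dk : \det (A k) != 0.
  near: k; have := dA; move/cvgrPdist_lt => /(_ `|\det L|).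
  rewrite normr_gt0 => /(_ dL); apply: filterS => k; apply: contraTN => /eqP ->.
  by rewrite subr0 ltxx.
have Ek : A k *m x k = y k by near: k.
by rewrite /= -Ek mulmxA mul_adj_mx mul_scalar_mx mxE mulKf.
Unshelve. all: by end_near. Qed.

(** * Limit of the connection coefficients *)

Lemma sqr_cvg1 (R : realType) (g : nat -> R) : (forall n, 0 < g n) ->
  g n ^+ 2 @[n --> \oo] --> (1 : R) -> g n @[n --> \oo] --> (1 : R).
Proof.
move=> g0 h; have : Num.sqrt (g n ^+ 2) @[n --> \oo] --> Num.sqrt (1 : R).
  by apply: continuous_cvg => //; exact: sqrt_continuous.
by rewrite sqrtr1; under eq_cvg do rewrite sqrtr_sqr gtr0_norm//.
Qed.

(** A Cauchy matrix with rows and columns scaled by nonzero factors; [cauchy_system_inj] makes its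
    left kernel trivial. *)
Lemma unitmx_cauchy (R : realFieldType) (n : nat) (f : 'I_n -> R) (b k : R) :
  0 < b -> 0 < k -> (forall i, f i != 0) ->
  \matrix_(i, j) (f i * f j / (b * (k + (j + i)%:R))) \in unitmx.
Proof.
move=> b0 k0 f0; rewrite -row_free_unit -kermx_eq0.
apply/rowV0P => v /sub_kermxP vL; apply/rowP => j; rewrite mxE.
have H := @cauchy_system_inj R n k (fun i => v 0 i * f i) k0.
suff /H /(_ j)/eqP : forall i : 'I_n,
    \sum_j v 0 j * f j / (k + i%:R + j%:R) = 0.
  by rewrite mulf_eq0 (negPf (f0 j)) orbF => /eqP.
move=> i; have /rowP/(_ i) := vL; rewrite !mxE => h.
apply: (mulfI (_ : f i / b != 0)).
  by rewrite mulf_neq0 ?invr_neq0// gt_eqF.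
rewrite mulr0 -[RHS]h mulr_sumr; apply: eq_bigr => l _.
rewrite mxE natrD; field.
by rewrite !gt_eqF// ltr_wpDr.
Qed.

(* [c] and [e] stand for the scaled Taylor coefficients of the [p_n] and [q_n],
   [g n] for the ratio of their leading coefficients, and [x n] for the unknowns
   of the linear system that determines the [q_n^(i)(c)] with [i <= r]. *)
Section connection_limit.
Context (R : realType).
Variables (r : nat) (M : 'I_r.+1 -> R) (s bt : nat -> R) (A a B b nu : R).
Variables (c e : nat -> nat -> R) (g : nat -> R) (f : nat -> R).
Hypotheses (M0 : forall i, 0 < M i).
Hypotheses (s0 : forall n, 0 < s n) (bt0 : forall n, 0 < bt n).
Hypotheses (A0 : 0 < A) (B0 : 0 < B) (b0 : 0 < b) (nu1 : -1 < nu).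
Hypothesis nu_ab : 2 * a + 1 = b * (nu + 1).
Hypothesis s_asym : asym_equiv (fun n => (s n)^-1) (fun n => A * n%:R `^ a).
Hypothesis bt_asym : asym_equiv bt (fun n => B * n%:R `^ b).
Hypothesis cf : forall i, c n i @[n --> \oo] --> f i.
Hypothesis cC : forall rho : R, 0 < rho ->
  exists C, forall n i, `|c n i| * rho ^+ i <= C.
Hypothesis f0 : forall i, f i != 0.
(** Up to scaling, M_i q_n^(i)(c). Thus [eE] is an implicit equation for the [e n i] with i <= r,
    and explicit for higher orders. *)
Let y n (i : 'I_r.+1) := M i * i`!%:R ^+ 2 * e n i / kernel_weight s bt (2 * i)
  n.
Let D n (i m : nat) := kernel_sum s bt (i + m) (fun k => c k i * c k m) n.
Hypothesis g0 : forall n, 0 < g n.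
Hypothesis eE : forall n m, e n m =
  g n * c n m - \sum_(i < r.+1) y n i * D n i m.
Hypothesis gE : forall n, (0 < n)%N ->
  g n * (g n + \sum_(i < r.+1) y n i * c n i / n%:R) = 1.
(** Division by [g n] leaves [c n i] as right-hand side of the system, so the unknowns converge
    before anything is known about the limit of [g]. *)
Let x n (i : 'I_r.+1) := y n i / g n.

Let k0 : 0 < nu + 1. Proof. by rewrite -ltrBlDr sub0r. Qed.

Lemma kernel_sum_coef_cvg (i m : nat) :
  D n i m @[n --> \oo] --> f i * f m / (b * (nu + 1 + (i + m)%:R)).
Proof.
by apply: (kernel_sum_cvg A0 B0 b0 nu1 nu_ab s_asym bt_asym); exact: cvgM.
Qed.

Lemma kernel_weight_gt0 (n i : nat) : (0 < n)%N -> 0 < kernel_weight s bt i n.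
Proof.
by move=> n0; rewrite divr_gt0 ?exprn_gt0// mulr_gt0 ?ltr0n ?exprn_gt0.
Qed.

Lemma scaled_coef_factor (n m : nat) : e n m =
  g n * (c n m - \sum_(i < r.+1) x n i * D n i m).
Proof.
rewrite eE mulrBr; congr (_ - _); rewrite mulr_sumr; apply: eq_bigr => i _.
by rewrite /x; field; rewrite gt_eqF.
Qed.

Lemma solution_cvg : exists2 w : 'I_r.+1 -> R,
  forall i, x n i @[n --> \oo] --> w i &
  forall i : 'I_r.+1, \sum_(j < r.+1) f j * w j / b / (nu + 1 + i%:R + j%:R) =
    1.
Proof.
(* For n > 0, [T n i * y n i] is [e n i]. The masses enter the matrix only here, and [T n i] tends
   to 0. *)
pose T n (i : 'I_r.+1) := kernel_weight s bt (2 * i) n / (M i * i`!%:R ^+ 2).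
pose S n := \matrix_(i < r.+1, j < r.+1) ((i == j)%:R * T n i + D n j i).
pose L := \matrix_(i < r.+1, j < r.+1)
  (f i * f j / (b * (nu + 1 + (j + i)%:R))).
have uL : L \in unitmx by exact: (unitmx_cauchy (f := fun i : 'I_r.+1 => f i)).
have SL i j : S n i j @[n --> \oo] --> L i j.
  have -> : L i j = 0 + f j * f i / (b * (nu + 1 + (j + i)%:R)).
    by rewrite mxE add0r [f i * _]mulrC.
  under eq_cvg do rewrite mxE.
  apply: cvgD; last exact: kernel_sum_coef_cvg.
  rewrite -(mulr0 (i == j)%:R); apply: cvgM; first exact: cvg_cst.
  rewrite -(mul0r (M i * i`!%:R ^+ 2)^-1); apply: cvgMl.
  exact: (@kernel_weight_cvg0 R s bt A a B b nu (2 * i)%N A0 B0 b0 nu1 nu_ab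
    s_asym bt_asym).
(* These are the relations [eE] for orders up to [r]; n = 0 is excluded because the weight then
   divides by zero. *)
have sys : \forall n \near \oo,
    S n *m (\col_i x n i) = \col_(i < r.+1) c n i.
  near=> n; have n0 : (0 < n)%N by near: n; exists 1%N.
  apply/colP => i; rewrite !mxE; under eq_bigr do rewrite !mxE mulrDl.
  rewrite big_split/= (bigD1 i)//= eqxx mul1r [X in _ + X + _]big1 => [|j ij].
    rewrite addr0.
    have -> : T n i * x n i = e n i / g n.
      rewrite /T /x /y; field.
      by rewrite !gt_eqF//; exact: kernel_weight_gt0.
    rewrite scaled_coef_factor mulrAC divff ?gt_eqF// mul1r.
    under [X in _ + X]eq_bigr do rewrite mulrC.
    by rewrite subrK.
  by rewrite eq_sym (negPf ij) !mul0r.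
exists (fun i => (invmx L *m \col_(i < r.+1) f i) i 0) => i.
  have cl j : (\col_(i < r.+1) c n i) j 0 @[n --> \oo] -->
      (\col_(i < r.+1) f i) j 0.
    by rewrite mxE; under eq_cvg do rewrite mxE; exact: cf.
  have := @cvg_linear_system R r.+1 S L (fun n => \col_i x n i)
    (fun n => \col_(i < r.+1) c n i) (\col_(i < r.+1) f i) SL uL cl sys i.
  by under eq_cvg do rewrite mxE.
have /colP/(_ i) := mulKVmx uL (\col_(i < r.+1) f i).
(* Dividing row [i] of the limit system by [f i] leaves a pure Cauchy system with right-hand side
   1. *)
rewrite mxE [RHS]mxE => h; apply: (mulfI (f0 i));
  rewrite mulr1 -[RHS]h mulr_sumr.
apply: eq_bigr => j _; rewrite [L i j]mxE natrD.
rewrite [j%:R + _]addrC; set w := (_ *m _) j 0; field.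
by rewrite !gt_eqF// ltr_wpDr.
Unshelve. all: by end_near. Qed.

(** In terms of [x], [gE] reads g^2 (1 + sum_i x_i c_i / n) = 1. The numerators converge, so the sum
    tends to 0, and positivity selects the root 1. *)
Lemma lead_ratio_cvg1 : g n @[n --> \oo] --> (1 : R).
Proof.
have [w xw _] := solution_cvg; apply: sqr_cvg1 => //.
have : (1 + \sum_(i < r.+1) x n i * c n i * n%:R^-1)^-1 @[n --> \oo] -->
  (1^-1 : R).
  apply: cvgV; first exact: oner_neq0.
  rewrite -[X in _ --> X]addr0; apply: cvgD; first exact: cvg_cst.
  rewrite -[X in _ --> X](@big1_eq _ 0 +%R _ (index_enum 'I_r.+1) xpredT).
  apply: (@cvg_big R _ +%R 0) => [|i _]; first exact: add_continuous.
  rewrite -(mulr0 (w i * f i)); apply: cvgM; first exact: cvgM.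
  by rewrite -cvg_shiftS; exact: cvg_harmonic.
rewrite invr1; apply: cvg_trans; apply: near_eq_cvg; near=> n.
have n0 : (0 < n)%N by near: n; exists 1%N.
have h : g n ^+ 2 * (1 + \sum_(i < r.+1) x n i * c n i * n%:R^-1) = 1.
  rewrite -[RHS](gE n0) mulrDr mulr1 [RHS]mulrDr expr2; congr (_ + _).
  rewrite !mulr_sumr; apply: eq_bigr => i _; rewrite /x; field.
  by rewrite !gt_eqF ?ltr0n.
have h0 : 1 + \sum_(i < r.+1) x n i * c n i * n%:R^-1 != 0.
  by apply/eqP => z; move/eqP : h; rewrite z mulr0 eq_sym oner_eq0.
by apply: (mulIf h0); rewrite h mulVf.
Unshelve. all: by end_near. Qed.

Lemma connection_cvg (m : nat) :
  e n m @[n --> \oo] -->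
    f m * \prod_(i < r.+1) ((m%:R - i%:R) / (m%:R + (nu + 1) + i%:R)).
Proof.
have [w xw wS] := solution_cvg.
rewrite -(cauchy_system_sol k0 wS) -[X in _ --> X]mul1r.
under eq_cvg do rewrite scaled_coef_factor.
apply: cvgM; first exact: lead_ratio_cvg1.
have -> : f m * (1 - \sum_(j < r.+1) f j * w j / b / (nu + 1 + m%:R + j%:R)) =
    f m - \sum_(j < r.+1) w j * (f j * f m / (b * (nu + 1 + (j + m)%:R))).
  rewrite mulrBr mulr1 mulr_sumr; congr (_ - _); apply: eq_bigr => j _.
  rewrite natrD [j%:R + _]addrC; field.
  by rewrite !gt_eqF// ltr_wpDr.
apply: cvgB => //; apply: (@cvg_big R _ +%R 0) => [|i _];
  first exact: add_continuous.
by apply: cvgM => //; exact: kernel_sum_coef_cvg.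
Qed.

Lemma connection_bound (rho : R) : 0 < rho -> exists C, \forall n \near \oo,
  forall m, `|e n m| * rho ^+ m <= C.
Proof.
move=> rho0; have [C CP] := cC (mulr_gt0 (ltr0Sn _ 3) rho0).
have [w xw _] := solution_cvg.
pose E n (i : nat) := kernel_sum s bt i (fun k => `|c k i|) n.
(* [bnd n] majorizes all orders [m] at once; as it converges to [l], it is eventually at most l +
   1. *)
pose bnd n := g n * (C + \sum_(i < r.+1) `|x n i| * (C * E n i)).
pose l := 1 * (C + \sum_(i < r.+1)
  `|w i| * (C * (`|f i| / (b * (nu + 1 + i%:R))))).
have bndl : bnd n @[n --> \oo] --> l.
  apply: cvgM; first exact: lead_ratio_cvg1.
  apply: cvgD; first exact: cvg_cst.
  apply: (@cvg_big R _ +%R 0) => [|i _]; first exact: add_continuous.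
  apply: cvgM; first exact: cvg_norm.
  apply: cvgM; first exact: cvg_cst.
  apply: (kernel_sum_cvg A0 B0 b0 nu1 nu_ab s_asym bt_asym).
  by apply: cvg_norm; exact: cf.
exists (l + 1); have /cvgrPdist_le/(_ _ ltr01) bl := bndl.
near=> n => m; apply: (@le_trans _ _ (bnd n)); last first.
  have : `|l - bnd n| <= 1 by near: n.
  by rewrite ler_distlC => /andP[_].
have H : forall k, (k < n)%N -> bt k <= 4 * bt n.
  by near: n; exact: regular_seq_almost_incr bt_asym.
rewrite scaled_coef_factor normrM (gtr0_norm (g0 n)) -mulrA ler_wpM2l
  ?(ltW (g0 n))//.
apply: (@le_trans _ _ ((`|c n m| + \sum_(i < r.+1) `|x n i| * `|D n i m|)
  * rho ^+ m)).
  rewrite ler_wpM2r ?exprn_ge0 ?(ltW rho0)//.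
  apply: (le_trans (ler_normB _ _)); rewrite lerD2l.
  apply: (le_trans (ler_norm_sum _ _ _)).
  by apply: ler_sum => i _; rewrite normrM.
rewrite mulrDl; apply: lerD.
  apply: le_trans (CP n m); rewrite ler_wpM2l//.
  by rewrite lerXn2r ?nnegrE ?mulr_ge0 ?(ltW rho0)// ler_peMl ?(ltW rho0)//
    ler1n.
rewrite mulr_suml; apply: ler_sum => i _; rewrite -mulrA ler_wpM2l//.
exact: kernel_sum_bound.
Unshelve. all: by end_near. Qed.
End connection_limit.

(** * Bessel coefficients *)

Lemma GammaDn (R : realType) (s : R) (n : nat) : 0 < s ->
  Gamma (s + n%:R) = \prod_(i < n) (s + i%:R) * Gamma s.
Proof.
move=> s0; elim: n => [|n IH]; first by rewrite big_ord0 mul1r addr0.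
have sn0 : 0 < s + n%:R by rewrite ltr_wpDr.
by rewrite -natr1 addrA (GammaS sn0) IH big_ord_recr/= mulrA [_ * (_ + _)]mulrC.
Qed.

(** The coefficient of z^(2m) in z^(-nu) J_nu(2z). *)
Definition bessel_coef (R : realType) (nu : R) (m : nat) : R :=
  (-1) ^+ m / (m`!%:R * Gamma (m%:R + nu + 1)).

Lemma bessel_coef_neq0 (R : realType) (nu : R) (m : nat) : -1 < nu ->
  bessel_coef nu m != 0.
Proof.
move=> nu1; have h : 0 < m%:R + nu + 1 by
  rewrite -addrA ltr_wpDl// -ltrBlDr sub0r.
rewrite mulf_neq0 ?signr_eq0// invr_neq0// gt_eqF// mulr_gt0 ?Gamma_gt0//. 
Qed.

Lemma expn_fact_le (R : realType) (x : R) (n : nat) : 0 <= x ->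
  x ^+ n / n`!%:R <= expR x.
Proof.
move=> x0; case: n => [|n]; first by rewrite expr0 divr1 -expR0 ler_expR.
by apply: le_trans (expR_ge1Dxn n x0); rewrite lerDr.
Qed.

(** The factors s + 1, s + 2, ... gained beyond [Gamma (s + 1)] are at least 1, but the first factor
    [s] may be smaller; hence two terms on the right. *)
Lemma Gamma_nat_ge (R : realType) (s : R) (n : nat) : 0 < s ->
  (Gamma (n%:R + s))^-1 <= (Gamma s)^-1 + (Gamma (s + 1))^-1.
Proof.
move=> s0; have G0 (t : R) : 0 < t -> 0 < (Gamma t)^-1.
  by move=> t0; rewrite invr_gt0 Gamma_gt0.
have s10 : 0 < s + 1 by rewrite ltr_wpDr.
have Gs := G0 _ s0; have Gs1 := G0 _ s10.
case: n => [|n]; first by rewrite add0r lerDl ltW.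
apply: (@le_trans _ _ (Gamma (s + 1))^-1); last by rewrite lerDr ltW.
rewrite [_ + s]addrC; elim: n => [//|n IH]; apply: le_trans IH.
have h : (1 : R) <= s + n.+1%:R by rewrite -natr1; have := ler0n R n; lra.
have h0 : 0 < s + n.+1%:R by exact: lt_le_trans h.
rewrite -[n.+2%:R]natr1 addrA (GammaS h0) invfM ler_piMl ?(ltW (G0 _ h0))//.
by rewrite invf_le1.
Qed.

Lemma bessel_coef_entire (R : realType) (nu : R) : -1 < nu ->
  entire_coefs (bessel_coef nu).
Proof.
move=> nu1 rho rho0; have s0 : 0 < nu + 1 by rewrite -ltrBlDr sub0r.
exists (expR rho * ((Gamma (nu + 1))^-1 + (Gamma (nu + 1 + 1))^-1)) => m.
rewrite /bessel_coef -addrA.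
have G0 : 0 < Gamma (m%:R + (nu + 1)) by rewrite Gamma_gt0// ltr_wpDl.
rewrite normrM normrX normrN1 expr1n mul1r normfV gtr0_norm; last first.
  by rewrite mulr_gt0// ltr0n fact_gt0.
rewrite invfM mulrAC [_^-1 * rho ^+ m]mulrC; apply: ler_pM.
- by rewrite divr_ge0 ?exprn_ge0// ltW.
- by rewrite invr_ge0 ltW.
- exact: expn_fact_le (ltW rho0).
- exact: Gamma_nat_ge.
Qed.

Lemma besselE_even_series (R : realType) (nu : R) :
  besselE (nu + (2 * 0)%:R) 0 = even_series (bessel_coef nu).
Proof.
apply/funext => z; rewrite /besselE /even_series.
apply: (congr1 (fun u : nat -> R[i]^o => limn (series u))).
apply/funext => k; rewrite muln0 !addr0 addn0 /bessel_coef.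
rewrite rmorphM rmorphXn rmorphN rmorph1 fmorphV rmorphM rmorph_nat.
by rewrite mulrAC.
Qed.

(** The limit coefficients of the scaled [q n]. The product vanishes for m <= r, so the series
    starts at z^(2r + 2). *)
Definition reduced_bessel_coef (R : realType) (nu : R) (r m : nat) : R :=
  bessel_coef nu m *
    \prod_(i < r.+1) ((m%:R - i%:R) / (m%:R + (nu + 1) + i%:R)).

(** Every factor of the product has absolute value at most 1 because nu + 1 > 0. *)
Lemma reduced_bessel_coef_entire (R : realType) (nu : R) (r : nat) : -1 < nu ->
  entire_coefs (reduced_bessel_coef nu r).
Proof.
move=> nu1 rho rho0; have [C CP] := bessel_coef_entire nu1 rho0.
have s0 : 0 < nu + 1 by rewrite -ltrBlDr sub0r.
exists C => m; apply: le_trans (CP m);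
  rewrite ler_wpM2r ?exprn_ge0 ?(ltW rho0)//.
rewrite normrM ler_piMr// normr_prod prodr_ile1// => i _.
have d0 : 0 < m%:R + (nu + 1) + i%:R by rewrite ltr_wpDr// ltr_wpDl.
rewrite normr_ge0 normrM normfV (gtr0_norm d0) ler_pdivrMr// mul1r.
have := ler0n R m; have := ler0n R i; rewrite ler_norml => h1 h2.
by apply/andP; split; lra.
Qed.

Lemma reduced_bessel_coef_small (R : realType) (nu : R) (r m : nat) :
  (m <= r)%N -> reduced_bessel_coef nu r m = 0.
Proof.
move=> mr; rewrite /reduced_bessel_coef.
by rewrite (bigD1 (Ordinal (mr : (m < r.+1)%N)))//= subrr !mul0r mulr0.
Qed.

Lemma prod_descending (R : realType) (k n : nat) :
  \prod_(i < n) ((k + n)%:R - i%:R) * k`!%:R = (k + n)`!%:R :> R.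
Proof.
elim: n => [|n IH]; first by rewrite big_ord0 mul1r addn0.
rewrite big_ord_recl/= subr0 addnS factS natrM -IH -mulrA; congr (_ * (_ * _)).
by apply: eq_bigr => i _; rewrite /bump/= add1n -!natr1; ring.
Qed.

(** With m = k + r + 1, the product of the m - i reduces m! to k!, and that of the m + nu + 1 + i
    raises the argument of [Gamma] by r + 1. *)
Lemma reduced_bessel_coef_shift (R : realType) (nu : R) (r k : nat) : -1 < nu ->
  reduced_bessel_coef nu r (k + r.+1) =
    (-1) ^+ r.+1 * ((-1) ^+ k /
      (k`!%:R * Gamma (k%:R + nu + (2 * r + 2)%:R + 1))).
Proof.
move=> nu1; rewrite /reduced_bessel_coef /bessel_coef.
set m := (k + r.+1)%N.
have s0 : 0 < m%:R + (nu + 1) by rewrite ltr_wpDl// -ltrBlDr sub0r.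
have -> : k%:R + nu + (2 * r + 2)%:R + 1 = m%:R + (nu + 1) + r.+1%:R.
  by rewrite /m mul2n -addnn !natrD -!natr1; ring.
rewrite (GammaDn r.+1 s0) -(@prod_descending R k r.+1) -/m
  -[m%:R + nu + 1]addrA.
rewrite big_split/= prodfV exprD.
have : Gamma (m%:R + (nu + 1)) != 0 by rewrite gt_eqF ?Gamma_gt0.
have : (k`!%:R : R) != 0 by rewrite pnatr_eq0 -lt0n fact_gt0.
have : \prod_(i < r.+1) (m%:R + (nu + 1) + i%:R) != 0.
  by apply/prodf_neq0 => i _; rewrite gt_eqF// ltr_wpDr.
have : \prod_(i < r.+1) (m%:R - i%:R) != 0 :> R.
  apply/prodf_neq0 => i _; rewrite subr_eq0 eqr_nat gtn_eqF//.
  by rewrite /m (leq_trans (ltn_ord i))// leq_addl.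
move: (\prod_(i < r.+1) _) (\prod_(i < r.+1) _) (Gamma _) => P Q G P0 Q0 k0 G0.
by field; rewrite P0 Q0 k0 G0.
Qed.

Lemma even_series_reduced (R : realType) (nu : R) (r : nat) (z : R[i]) :
  -1 < nu ->
  even_series (reduced_bessel_coef nu r) z =
    (-1) ^+ r.+1 * besselE nu (2 * r + 2) z.
Proof.
move=> nu1; set f := reduced_bessel_coef nu r.
pose u m : R[i]^o := (f m)%:C * z ^+ (2 * m).
pose v k : R[i]^o := (-1) ^+ k * z ^+ (2 * k + (2 * r + 2))
     / (k`!%:R * (Gamma (k%:R + nu + (2 * r + 2)%:R + 1))%:C).
have rho0 : 0 < normc z ^+ 2 + 1 by rewrite ltr_wpDl// exprn_ge0// normc_ge0.
have [C fC] := reduced_bessel_coef_entire r nu1 (mulr_gt0 (ltr0Sn R 1) rho0).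
have zrho : normc z ^+ 2 <= normc z ^+ 2 + 1 by rewrite lerDl.
have [cu _] := @complex_series_cvg R u C (fun i => even_term_le zrho (fC i)).
have uv k : u (k + r.+1)%N = (-1) ^+ r.+1 * v k.
  rewrite /u /v /f reduced_bessel_coef_shift// rmorphM rmorphXn rmorphN rmorph1.
  rewrite rmorphM fmorphV rmorphM rmorph_nat rmorphXn rmorphN rmorph1 -!mulrA.
  congr (_ * (_ * _)); rewrite [RHS]mulrC; congr (_ * _).
  by congr (z ^+ _); rewrite mulnDr mulnS [(2 * r + 2)%N]addnC.
(* The first r + 1 terms of [u] vanish, and the sign is its own inverse. *)
have suv n : series v n = ((-1) ^+ r.+1 : R[i]) *: series u (n + r.+1)%N.
  rewrite /series/= !big_mkord addnC big_split_ord/=.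
  rewrite [X in _ *: (X + _)]big1 ?add0r => [|i _].
    rewrite scaler_sumr; apply: eq_bigr => k _.
    rewrite /= addnC uv /GRing.scale/= mulrA -exprD addnn -mul2n exprM.
    by rewrite sqrrN !expr1n mul1r.
  by rewrite /u /f reduced_bessel_coef_small ?mul0r// -ltnS.
have cv : series v @ \oo --> ((-1) ^+ r.+1 : R[i]) *: limn (series u).
  under eq_cvg do rewrite suv.
  by apply: cvgZl_tmp; rewrite cvg_shiftn.
rewrite /besselE -/v (cvg_lim _ cv)//.
rewrite /GRing.scale/= mulrA -exprD addnn -mul2n exprM sqrrN !expr1n mul1r.
by [].
Qed.

(** * Taylor coefficients of the scaled polynomials *)

Lemma chorner_taylor (R : realType) (P : {poly R}) (n : nat) (c : R)
    (w : R[i]) :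
  size P = n.+1 ->
  chorner P (c%:C + w) = \sum_(i < n.+1) (P^`N(i).[c])%:C * w ^+ i.
Proof.
move=> sP; rewrite /chorner nderiv_taylor; last exact: mulrC.
rewrite size_map_poly sP; apply: eq_bigr => i _.
by rewrite nderivn_map horner_map.
Qed.

Lemma scaled_chorner (R : realType) (P : {poly R}) (n : nat) (c s b : R)
    (z : R[i]) : size P = n.+1 ->
  (-1) ^+ n * s%:C * chorner P (c%:C + z ^+ 2 / b%:C) =
  \sum_(i < n.+1) ((-1) ^+ n * s * P^`N(i).[c] / b ^+ i)%:C * z ^+ (2 * i).
Proof.
move=> sP; rewrite (chorner_taylor _ _ sP) mulr_sumr; apply: eq_bigr => i _.
rewrite exprMn exprVn -exprM -rmorphXn -fmorphV !rmorphM rmorphXn rmorphN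
  rmorph1.
by ring.
Qed.

(** The coefficient of z^(2m) in (-1)^n s_n Q_n(c + z^2 / b_n); the normalized derivative carries
    the factor 1/m!. *)
Definition scaled_coef (R : realType) (s b : nat -> R) (c : R)
    (Q : nat -> {poly R}) (n m : nat) : R :=
  (-1) ^+ n * s n * (Q n)^`N(m).[c] / b n ^+ m.

Lemma scaled_coef_eq0 (R : realType) (s b : nat -> R) (c : R)
    (Q : nat -> {poly R}) (n m : nat) :
  size (Q n) = n.+1 -> (n < m)%N -> scaled_coef s b c Q n m = 0.
Proof.
move=> sQ nm; rewrite /scaled_coef nderivn_poly0 ?sQ//.
by rewrite horner0 mulr0 mul0r.
Qed.

Lemma sign_sqr (R : pzRingType) (l : nat) : (-1) ^+ l * (-1) ^+ l = 1 :> R.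
Proof. by rewrite -exprD addnn -mul2n exprM sqrrN !expr1n. Qed.

Lemma nderivn_scaled_coef (R : realType) (s b : nat -> R) (c : R)
    (Q : nat -> {poly R}) (n i : nat) : s n != 0 -> b n != 0 ->
  (Q n)^`N(i).[c] = (-1) ^+ n * scaled_coef s b c Q n i * b n ^+ i / s n.
Proof.
move=> s0 b0; have bi : b n ^+ i != 0 by rewrite expf_neq0.
rewrite /scaled_coef -!mulrA mulrA sign_sqr mul1r.
by field; rewrite bi s0.
Qed.

Lemma derivn_scaled_coef (R : realType) (s b : nat -> R) (c : R)
    (Q : nat -> {poly R}) (n i : nat) : s n != 0 -> b n != 0 ->
  (Q n)^`(i).[c] =
    (-1) ^+ n * scaled_coef s b c Q n i * i`!%:R * b n ^+ i / s n.
Proof.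
move=> s0 b0; rewrite nderivn_def hornerMn -mulr_natr.
by rewrite (nderivn_scaled_coef _ _ _ s0 b0); ring.
Qed.

(** The signs (-1)^n and (-1)^k each occur twice and cancel; the quotient of the weights of orders i
    + m and 2i is b_n^(i - m), the scaling left over from the derivatives at c. *)
Lemma scaled_connection (R : realType) (s b : nat -> R) (c : R) (r : nat)
    (M : 'I_r.+1 -> R) (p q : nat -> {poly R}) (g : R) (n m : nat) :
  (forall n, s n != 0) -> (forall n, b n != 0) ->
  q n = g *: p n - \sum_(k < n)
    (\sum_(i < r.+1) M i * (q n)^`(i).[c] * (p k)^`(i).[c]) *: p k ->
  let e := scaled_coef s b c q in let u := scaled_coef s b c p in
  e n m = g * u n m - \sum_(i < r.+1)
    (M i * i`!%:R ^+ 2 * e n i / kernel_weight s b (2 * i) n) *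
    kernel_sum s b (i + m) (fun k => u k i * u k m) n.
Proof.
move=> s0 b0 qE e u; have [bn sn] := (b0 n, s0 n).
rewrite {1}/e {1}/scaled_coef qE nderivnB nderivnZ hornerD hornerN hornerZ.
rewrite mulrBr mulrBl; congr (_ - _); first by rewrite /u /scaled_coef; ring.
have -> : (\sum_(k < n) (\sum_(i < r.+1) M i * (q n)^`(i).[c] * (p k)^`(i).[c])
    *: p k)^`N(m).[c] = \sum_(i < r.+1) \sum_(k < n)
    M i * (q n)^`(i).[c] * (p k)^`(i).[c] * (p k)^`N(m).[c].
  rewrite linear_sum horner_sum exchange_big/=; apply: eq_bigr => k _.
  by rewrite nderivnZ hornerZ mulr_suml.
rewrite mulr_sumr mulr_suml; apply: eq_bigr => i _.
rewrite /kernel_sum !mulr_sumr mulr_suml; apply: eq_bigr => k _.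
have n0 : n%:R != 0 :> R.
  by rewrite pnatr_eq0 -lt0n; exact: leq_ltn_trans (ltn_ord k).
have [bk sk] := (b0 k, s0 k).
rewrite (nderivn_scaled_coef _ _ _ sk bk) (derivn_scaled_coef _ _ _ sn bn).
rewrite (derivn_scaled_coef _ _ _ sk bk) -/e -/u.
rewrite /kernel_weight [b n ^+ (i + m)]exprD [b k ^+ (i + m)]exprD exprM.
have v0 : b n ^+ m != 0 by rewrite expf_neq0.
have u0 : b n ^+ i != 0 by rewrite expf_neq0.
transitivity (((-1) ^+ n * (-1) ^+ n) * ((-1) ^+ k * (-1) ^+ k) *
  (M i * i`!%:R ^+ 2 * e n i * (b n ^+ i / b n ^+ m) *
  (b k ^+ i * b k ^+ m / s k ^+ 2 * (u k i * u k m)))).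
  by field; rewrite sk v0 sn.
rewrite !sign_sqr !mul1r exprAC.
by field; rewrite sk v0 u0 n0 sn.
Qed.

(** The division by n undoes the factor n that comes from dividing by the kernel weight. *)
Lemma scaled_connection_norm (R : realType) (s b : nat -> R) (c : R) (r : nat)
    (M : 'I_r.+1 -> R) (p q : nat -> {poly R}) (n : nat) :
  s n != 0 -> b n != 0 -> (0 < n)%N ->
  let e := scaled_coef s b c q in let u := scaled_coef s b c p in
  \sum_(i < r.+1)
    (M i * i`!%:R ^+ 2 * e n i / kernel_weight s b (2 * i) n) * u n i / n%:R =
  \sum_(i < r.+1) M i * (q n)^`(i).[c] * (p n)^`(i).[c].
Proof.
move=> s0 b0 n0 e u; apply: eq_bigr => i _.
rewrite !(derivn_scaled_coef _ _ _ s0 b0) -/e -/u /kernel_weight exprM.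
have bi : b n ^+ i != 0 by rewrite expf_neq0.
have nR : n%:R != 0 :> R by rewrite pnatr_eq0 -lt0n.
transitivity (((-1) ^+ n * (-1) ^+ n) *
  (M i * i`!%:R ^+ 2 * e n i * u n i * (b n ^+ i) ^+ 2 / s n ^+ 2)).
  rewrite sign_sqr mul1r [(b n ^+ 2) ^+ i]exprAC.
  by field; rewrite s0 nR bi.
by field; rewrite s0.
Qed.

Theorem theorem5 (R : realType)
    (mu : {finite_measure set (measurableTypeR R) -> \bar R})
    (I : interval R) (c : R)
    (r : nat) (M : 'I_r.+1 -> R)
    (p : nat -> nat -> {poly R}) (q : nat -> {poly R})
    (alpha beta : nat -> R) (A a B b nu : R)
    (mu_moments : forall n : nat, mu.-integrable setT (fun x => (x ^+ n)%:E))
    (mu_infinite : infinite_set (msupport mu))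
    (mu_I : mu (~` [set` I]) = 0%E)
    (I_inf : has_inf [set` I]) (c_inf : c = inf [set` I])
    (M_gt0 : forall i, 0 < M i)
    (p_orth : forall j : nat, orthonormal_polys (weighted_ip mu c j) (p j))
    (q_orth : orthonormal_polys (sobolev_ip mu c M) q)
    (alpha_gt0 : forall n, 0 < alpha n) (beta_gt0 : forall n, 0 < beta n)
    (A_gt0 : 0 < A) (B_gt0 : 0 < B) (b_gt0 : 0 < b)
    (alpha_asym : asym_equiv (fun n => (Num.sqrt (alpha n))^-1)
                             (fun n => A * n%:R `^ a))
    (beta_asym : asym_equiv beta (fun n => B * n%:R `^ b))
    (nu_gtN1 : -1 < nu) (nu_ab : 2 * a + 1 = b * (nu + 1))
    (p_lim : forall j : nat, (j <= r.+1)%N ->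
       cvg_unif_compacts
         (fun n z => (-1) ^+ n * (Num.sqrt (alpha n) / beta n ^+ j)%:C
                     * chorner (p j n) (c%:C + z ^+ 2 / (beta n)%:C))
         (besselE (nu + (2 * j)%:R) 0)) :
  cvg_unif_compacts
    (fun n z => (-1) ^+ n * (Num.sqrt (alpha n))%:C
                * chorner (q n) (c%:C + z ^+ 2 / (beta n)%:C))
    (fun z => (-1) ^+ r.+1 * besselE nu (2 * r + 2) z).
Proof.
pose s n := Num.sqrt (alpha n).
have s0 n : 0 < s n by rewrite sqrtr_gt0.
have sn0 n : s n != 0 by rewrite gt_eqF.
have bn0 n : beta n != 0 by rewrite gt_eqF.
pose P := p 0%N; pose u := scaled_coef s beta c P.
pose e := scaled_coef s beta c q.
have oP := p_orth 0%N.
have [sP _ _] := oP; have [sq _ _] := q_orth.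
have u0 n m : (n < m)%N -> u n m = 0 by exact: scaled_coef_eq0.
have e0 n m : (n < m)%N -> e n m = 0 by exact: scaled_coef_eq0.
have [uf uC] : (forall i, u n i @[n --> \oo] --> bessel_coef nu i) /\
    (forall rho : R, 0 < rho -> exists C, forall n i, `|u n i| * rho ^+ i <= C).
  apply: (coef_of_unif u0 (bessel_coef_entire nu_gtN1)).
  have := p_lim 0%N (leq0n _); rewrite besselE_even_series.
  congr (cvg_unif_compacts _ _); apply/funext => n; apply/funext => z.
  by rewrite expr0 divr1 scaled_chorner.
have [g gE] := choice (sobolev_connection mu_moments oP q_orth).
have g0 n : 0 < g n by have [] := gE n.
have eE n m : e n m = g n * u n m - \sum_(i < r.+1)
    (M i * i`!%:R ^+ 2 * e n i / kernel_weight s beta (2 * i) n) *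
    kernel_sum s beta (i + m) (fun k => u k i * u k m) n.
  by have [_ qE _] := gE n; exact: scaled_connection.
have g1 n : (0 < n)%N -> g n * (g n + \sum_(i < r.+1)
    (M i * i`!%:R ^+ 2 * e n i / kernel_weight s beta (2 * i) n) * u n i /
      n%:R) = 1.
  by move=> n0; rewrite scaled_connection_norm//; have [] := gE n.
have f0 i := bessel_coef_neq0 i nu_gtN1.
have ecvg := connection_cvg M_gt0 s0 beta_gt0 A_gt0 B_gt0 b_gt0 nu_gtN1 nu_ab
  alpha_asym beta_asym uf f0 g0 eE g1.
have ebnd := connection_bound M_gt0 s0 beta_gt0 A_gt0 B_gt0 b_gt0 nu_gtN1 nu_ab
  alpha_asym beta_asym uf uC f0 g0 eE g1.
(* The limits supplied by [ecvg] are [reduced_bessel_coef nu r] by definition. *)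
have := unif_of_coef e0 (reduced_bessel_coef_entire r nu_gtN1) ecvg ebnd.
congr (cvg_unif_compacts _ _).
  by apply/funext => n; apply/funext => z; rewrite scaled_chorner.
by apply/funext => z; rewrite even_series_reduced.
Qed.
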